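(* Let $\theta>0$, $h>0$, and let $H=L^2([0,h],\beta_{[0,h]},\lambda+\delta_{(h)})$. Let $\{\xi_t,\ t\in\mathbb{R}\}$ be the Ornstein-Uhlenbeck process with parameter $\theta$, and for each integer $n\ge 1$ let $\widehat{\theta}_n$ be the maximum likelihood estimator of $\theta$ based on the observation of $\xi$ on $[0,T]$ with $T=nh$. Then the estimator $\rho_{\widehat{\theta}_n}$ of the operator $\rho_\theta$ is strongly consistent in the norm of $\mathcal{L}(H)$, i.e. $$\|\rho_\theta-\rho_{\widehat{\theta}_n}\|_{\mathcal{L}(H)}\longrightarrow 0\quad\text{almost surely, as } n\to\infty.$$
   Context: $W=\{W_t,\ t\in\mathbb{R}\}$ is a standard bilateral (two-sided) Wiener process on a probability space $(\Omega,\mathcal{A},\mathcal{P})$. The Ornstein-Uhlenbeck (O.U.) process with parameter $\theta>0$ is the zero-mean stationary Gaussian process with continuous sample paths $\xi_t=\int_{-\infty}^{t}e^{-\theta(t-s)}\,dW_s$, $t\in\mathbb{R}$ (covariance $\frac{1}{2\theta}e^{-\theta|t-s|}$). $\beta_{[0,h]}$ is the Borel $\sigma$-algebra of $[0,h]$, $\lambda$ is Lebesgue measure and $\delta_{(h)}$ is the Dirac measure at the point $h$. The norm of $H$ is $\|f\|_H=\sqrt{\int_0^h f(t)^2\,dt+f(h)^2}$; two functions are identified iff they agree Lebesgue-a.e. and at the point $h$, so $x\mapsto x(h)$ is well defined on $H$. $\mathcal{L}(H)$ is the space of bounded linear operators on $H$ with the operator norm. For a real number $u$, the operator $\rho_u$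 is defined by $\rho_u(x)(t)=e^{-ut}x(h)$, $0\le t\le h$, $x\in H$. In particular $\rho_{\widehat{\theta}_n}(x)(t)=e^{-\widehat{\theta}_n t}x(h)$. The maximum likelihood estimator of $\theta$ based on $\{\xi_t,\ t\in[0,T]\}$ is $$\widehat{\theta}_T=\frac{1+\frac{\xi_0^2}{T}-\frac{\xi_T^2}{T}}{\frac{2}{T}\int_0^T\xi_t^2\,dt},\quad T>0,$$ and $\widehat{\theta}_n$ denotes this estimator with $T=nh$. *)

(* Defs.v *)
From HB Require Import structures.
From mathcomp Require Import all_boot all_order all_algebra.
From mathcomp Require Import all_classical all_reals all_analysis.
From mathcomp Require Import measurable_realfun.
From mathcomp Require Import ring lra.

Set Implicit Arguments.
Unset Strict Implicit.
Unset Printing Implicit Defensive.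

Import Order.TTheory GRing.Theory Num.Theory.
Import numFieldNormedType.Exports.

Local Open Scope classical_set_scope.
Local Open Scope ring_scope.

(* The library defines the type LspaceType2 mu of classes, modulo mu-almost    *)
(* everywhere equality, of square-integrable functions, but gives it neither a *)
(* vector space structure nor a norm. The coercion from a class to functions   *)
(* picks a representative.                                                     *)
Definition L2 d (T : measurableType d) (R : realType)
  (mu : {measure set T -> \bar R}) : Type := LspaceType2 mu.

Section L2_structure.
Context d (T : measurableType d) (R : realType).
Variable mu : {measure set T -> \bar R}.
Local Notation L2fun := (LfunType mu (lee1n 2)).
Local Notation cls := ({mfun_ mu, T >-> measurableTypeR R}).

Lemma ae_Lnorm2 (f g : T -> R) :
  measurable_fun [set: T] f -> measurable_fun [set: T] g -> f = g %[ae mu] ->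
  'N[mu]_2[EFin \o f]%E = 'N[mu]_2[EFin \o g]%E.
Proof.
move=> mf mg fg; rewrite unlock; congr (_ `^ _)%E.
have mp (k : T -> R) : measurable_fun [set: T] k ->
    measurable_fun [set: T] (fun x : T => (`|k x| `^ 2)%:E : \bar R).
  move=> mk; apply/measurable_EFinP.
  apply/(@measurableT_comp _ _ _ _ _ _ (fun y : R => y `^ 2)) => //.
  exact: measurableT_comp.
apply: ge0_ae_eq_integral => //; [exact: mp|exact: mp| | |];
  try by move=> x _; exact: poweR_ge0.
by apply: filterS fg => x + xT => /(_ xT) /= ->.
Qed.

Definition L2_fun (x : L2 mu) : T -> R := (LebesgueSpace.sort x : cls).

Lemma measurable_L2_fun (x : L2 mu) : measurable_fun [set: T] (L2_fun x).
Proof. exact: (@measurable_funPT _ _ _ _ (repr (LebesgueSpace.sort x : cls))). Qed.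

Lemma L2_fun_Lfun (x : L2 mu) : L2_fun x \in Lfun mu 2%:E.
Proof.
rewrite inE; apply/andP; split; rewrite inE; first exact: measurable_L2_fun.
exact: Lebesgue_finite.
Qed.

Definition L2_rep (x : L2 mu) : L2fun := Lfun_Sub (lee1n 2) (L2_fun_Lfun x).

Section classes.
Variable f : L2fun.

Let mf : (f : T -> measurableTypeR R) \in mfun.
Proof. by rewrite inE; exact: (@measurable_funPT _ _ _ _ f). Qed.

Let c : cls := (\pi_(cls) (mfun_Sub mf))%qT.

Let ae_c : (c : T -> R) = f %[ae mu].
Proof.
have /eqP : (repr c = mfun_Sub mf %[mod cls])%qT by rewrite reprK.
by rewrite eqmodE => /asboolP.
Qed.

Let c_finite : finite_norm mu 2 (c : T -> R).
Proof.
rewrite /finite_norm (@ae_Lnorm2 _ f)//; first exact: (@Lfunction_finite _ _ _ mu _ (lee1n 2) f).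
exact: (@measurable_funPT _ _ _ _ (repr c)).
Qed.

Definition L2_class : L2 mu :=
  LebesgueSpace.Pack (LebesgueSpace.Class
    (isFinLebesgue.Axioms_ T R mu 2%:E (lee1n 2) c c_finite)).

Lemma L2_classE : {ae mu, forall t, L2_fun L2_class t = f t}.
Proof. by apply: filterS ae_c => t /(_ I). Qed.

End classes.

Lemma L2_ext (x y : L2 mu) : {ae mu, forall t, L2_fun x t = L2_fun y t} -> x = y.
Proof.
case: x y => [x [[xf]]] [y [[yf]]]; rewrite /L2_fun/= => xy.
have {}xy : x = y.
  have /ae_eqP/eqP : (x : T -> measurableTypeR R) = y %[ae mu].
    by apply: filterS xy.
  by rewrite !reprK.
by subst y; rewrite (Prop_irrelevance xf yf).
Qed.

Definition L2_zero : L2 mu := L2_class 0.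
Definition L2_opp (x : L2 mu) : L2 mu := L2_class (- L2_rep x).
Definition L2_add (x y : L2 mu) : L2 mu := L2_class (L2_rep x + L2_rep y).
Definition L2_scale (a : R) (x : L2 mu) : L2 mu := L2_class (a *: L2_rep x).
Definition L2_norm (x : L2 mu) : R := fine 'N[mu]_2[EFin \o L2_fun x]%E.

Lemma L2_zeroE : {ae mu, forall t, L2_fun L2_zero t = 0}.
Proof. exact: L2_classE. Qed.

Lemma L2_oppE x : {ae mu, forall t, L2_fun (L2_opp x) t = - L2_fun x t}.
Proof. exact: L2_classE. Qed.

Lemma L2_addE x y :
  {ae mu, forall t, L2_fun (L2_add x y) t = L2_fun x t + L2_fun y t}.
Proof. exact: L2_classE. Qed.

Lemma L2_scaleE a x : {ae mu, forall t, L2_fun (L2_scale a x) t = a * L2_fun x t}.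
Proof. exact: L2_classE. Qed.

Let addA : associative L2_add.
Proof.
move=> x y z; apply: L2_ext.
apply: filterS3 (filterI (L2_addE x (L2_add y z)) (L2_addE y z))
  (L2_addE (L2_add x y) z) (L2_addE x y) => t [-> ->] -> ->.
by rewrite addrA.
Qed.

Let addC : commutative L2_add.
Proof.
move=> x y; apply: L2_ext.
by apply: filterS2 (L2_addE x y) (L2_addE y x) => t -> ->; rewrite addrC.
Qed.

Let add0 : left_id L2_zero L2_add.
Proof.
move=> x; apply: L2_ext.
by apply: filterS2 (L2_addE L2_zero x) L2_zeroE => t -> ->; rewrite add0r.
Qed.

Let addN : left_inverse L2_zero L2_opp L2_add.
Proof.
move=> x; apply: L2_ext.
apply: filterS3 (L2_addE (L2_opp x) x) (L2_oppE x) L2_zeroE => t -> -> ->.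
by rewrite addNr.
Qed.

HB.instance Definition _ := gen_eqMixin (L2 mu).
HB.instance Definition _ := gen_choiceMixin (L2 mu).
HB.instance Definition _ := GRing.isZmodule.Build (L2 mu) addA addC add0 addN.

Let scaleA a b x : L2_scale a (L2_scale b x) = L2_scale (a * b) x.
Proof.
apply: L2_ext; apply: filterS3 (L2_scaleE a (L2_scale b x)) (L2_scaleE b x)
  (L2_scaleE (a * b) x) => t -> -> ->.
by rewrite mulrA.
Qed.

Let scale1 : left_id 1 L2_scale.
Proof.
by move=> x; apply: L2_ext; apply: filterS (L2_scaleE 1 x) => t ->; rewrite mul1r.
Qed.

Let scaleDr : right_distributive L2_scale +%R.
Proof.
move=> a x y; apply: L2_ext.
apply: filterS3 (filterI (L2_scaleE a (x + y)) (L2_addE x y))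
  (L2_addE (L2_scale a x) (L2_scale a y))
  (filterI (L2_scaleE a x) (L2_scaleE a y)) => t [-> ->] -> [-> ->].
by rewrite mulrDr.
Qed.

Let scaleDl x : {morph L2_scale^~ x : a b / a + b}.
Proof.
move=> a b; apply: L2_ext.
apply: filterS3 (L2_scaleE (a + b) x)
  (L2_addE (L2_scale a x) (L2_scale b x))
  (filterI (L2_scaleE a x) (L2_scaleE b x)) => t -> -> [-> ->].
by rewrite mulrDl.
Qed.

HB.instance Definition _ := GRing.Zmodule_isLmodule.Build R (L2 mu)
  scaleA scale1 scaleDr scaleDl.

Lemma L2_norm_class (f : L2fun) : L2_norm (L2_class f) = fine 'N[mu]_2[EFin \o f]%E.
Proof.
congr fine; apply: ae_Lnorm2; first exact: measurable_L2_fun.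
  exact: (@measurable_funPT _ _ _ _ f).
by apply: filterS (L2_classE f).
Qed.

Let normD x y : L2_norm (x + y) <= L2_norm x + L2_norm y.
Proof. by rewrite L2_norm_class; exact: (ler_LnormD (L2_rep x) (L2_rep y)). Qed.

Let normZ a x : L2_norm (a *: x) = `|a| * L2_norm x.
Proof.
rewrite L2_norm_class; apply/EFin_inj.
have xE := finite_norm_fine (L2_rep x); rewrite /= in xE.
have axE := finite_norm_fine (a *: L2_rep x); rewrite /= in axE.
rewrite axE EFinM [X in (_ * X)%E]xE.
exact: (LnormZ (L2_rep x) a).
Qed.

Let norm_eq0 x : L2_norm x = 0 -> x = 0.
Proof.
move=> /(@fine_Lnormr_eq0 _ _ _ _ _ _ (L2_rep x)) x0; apply: L2_ext.
by apply: filterS2 x0 L2_zeroE => t /(_ I) /= -> ->.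
Qed.

HB.instance Definition _ := Lmodule_isNormed.Build R (L2 mu) normD normZ norm_eq0.

End L2_structure.

(* Valued in the extended reals: it is +oo when f is an unbounded operator. *)
Definition opnorm (R : realType) (V W : normedModType R) (f : V -> W) : \bar R :=
  ereal_sup [set `|f x|%:E | x in [set x : V | `|x| <= 1]].

Section autoregression_operator.
Context {R : realType}.
Implicit Types h u : R.

(* The measure lambda + delta_(h) on [0, h], seen as a measure on R carried by *)
(* [0, h].                                                                     *)
Definition lambda_delta h : set (measurableTypeR R) -> \bar R :=
  mrestr (measure_add lebesgue_measure (@dirac _ (measurableTypeR R) h R))
    (measurable_itv `[0, h]).

HB.instance Definition _ h := Measure.on (lambda_delta h).

Definition H h := L2 (lambda_delta h).

Definition rho_fun h u (c : R) (t : measurableTypeR R) : R :=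
  \1_`[0, h]%classic t * (expR (- u * t) * c).

Lemma rho_fun_Lfun h u c : rho_fun h u c \in Lfun (lambda_delta h) 2%:E.
Proof.
have mf : measurable_fun [set: measurableTypeR R] (rho_fun h u c).
  apply: measurable_funM; first exact: measurable_indic.
  apply: measurable_funM => //.
  by apply: measurableT_comp => //; exact: measurable_funM.
rewrite inE; apply/andP; split; rewrite inE//.
pose C := expR (`|u| * `|h|) * `|c|.
have fC t : `|rho_fun h u c t| <= C.
  rewrite /rho_fun /C normrM indicE; case: (boolP (t \in _)) => [|_]; last first.
    by rewrite normr0 mul0r mulr_ge0// expR_ge0.
  rewrite inE/= in_itv/= => /andP[t0 th].
  rewrite normr1 mul1r normrM ler_wpM2r// ger0_norm ?expR_ge0// ler_expR.
  rewrite (le_trans (ler_norm _))// normrM normrN ler_wpM2l//.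
  by rewrite !ger0_norm// (le_trans t0).
have muT : (lambda_delta h [set: _] < +oo)%E.
  rewrite /lambda_delta /mrestr setTI /= measure_addE lte_add_pinfty//.
    by rewrite /= lebesgue_measure_itv/=; case: ifP => _; rewrite ?ltry// -EFinD ltry.
  by rewrite /= diracE ltry.
rewrite /= /finite_norm unlock; apply: poweR_lty.
apply: (@le_lt_trans _ _ (\int[lambda_delta h]_x (C `^ 2)%:E)%E); last first.
  by rewrite integral_cst// lte_mul_pinfty// lee_fin powR_ge0.
apply: ge0_le_integral => //.
- by move=> x _; exact: poweR_ge0.
- apply/measurable_EFinP.
  apply/(@measurableT_comp _ _ _ _ _ _ (fun y : R => y `^ 2)) => //.
  exact: measurableT_comp.
- by move=> x _; rewrite lee_fin ge0_ler_powR// nnegrE (le_trans _ (fC x)).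
Qed.

(* L2_fun x h does not depend on the representative of the class x, because h  *)
(* is an atom of lambda_delta h.                                               *)
Definition rho h u (x : H h) : H h :=
  L2_class (Lfun_Sub (lee1n 2) (rho_fun_Lfun h u (L2_fun x h))).

Lemma ae_lambda_delta_atom h (Q : R -> Prop) : 0 < h ->
  {ae lambda_delta h, forall t, Q t} -> Q h.
Proof.
move=> h0 [N [mN N0 QN]]; apply: contrapT => nQh.
have Nh : N h by exact: QN.
move: N0; rewrite /lambda_delta /mrestr /= measure_addE => /eqP.
rewrite padde_eq0// => /andP[_ /eqP].
rewrite /= diracE mem_set; first by move=> /eqP; rewrite onee_eq0.
by split => //=; rewrite in_itv/= lexx ltW.
Qed.

Lemma rho_linear h u : 0 < h -> linear (@rho h u).
Proof.
move=> h0 a x y; apply: L2_ext.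
have E : L2_fun (a *: x + y) h = a * L2_fun x h + L2_fun y h.
  apply: (@ae_lambda_delta_atom h
    (fun t => L2_fun (a *: x + y) t = a * L2_fun x t + L2_fun y t)) => //.
  by apply: filterS2 (L2_addE (a *: x) y) (L2_scaleE a x) => t -> ->.
apply: filterS3 (filterI (L2_addE (a *: rho u x) (rho u y))
    (L2_scaleE a (rho u x)))
  (L2_classE (Lfun_Sub (lee1n 2) (rho_fun_Lfun h u (L2_fun (a *: x + y) h))))
  (filterI (L2_classE (Lfun_Sub (lee1n 2) (rho_fun_Lfun h u (L2_fun x h))))
   (L2_classE (Lfun_Sub (lee1n 2) (rho_fun_Lfun h u (L2_fun y h))))) => t.
move=> [-> ->] -> [-> ->]; rewrite /= /rho_fun E; ring.
Qed.

Lemma H_normE h (x : H h) : 0 < h -> `|x| = Num.sqrt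
  (\int[lebesgue_measure]_(t in `[0, h]) (L2_fun x t ^+ 2) + L2_fun x h ^+ 2).
Proof.
move=> h0; pose D : set (measurableTypeR R) := `[0, h]%classic.
have mD : measurable D by exact: measurable_itv.
pose F t := ((L2_fun x t) ^+ 2)%:E.
have F0 t : (0 <= F t)%E by rewrite lee_fin sqr_ge0.
have mF : measurable_fun setT F.
  apply/measurable_EFinP; apply: measurable_funX; exact: measurable_L2_fun.
have mFS (S : set (measurableTypeR R)) : measurable_fun S F.
  exact: measurable_funTS.
have I : (\int[lambda_delta h]_t F t =
    \int[lebesgue_measure]_(t in D) F t + (L2_fun x h ^+ 2)%:E)%E.
  rewrite -(setUv D) ge0_integral_setU//=; first last.
  - by apply/disj_set2P; rewrite setICr.
  - exact: measurableC.
  rewrite [X in (_ + X)%E]null_set_integral//; first last.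
  - rewrite -[LHS]/(lambda_delta h (~` D)) /lambda_delta /mrestr setICl; exact: measure0.
  - exact: measurableC.
  rewrite adde0 (@eq_measure_integral _ _ _ D
    (measure_add lebesgue_measure (@dirac _ (measurableTypeR R) h R))).
    rewrite ge0_integral_measure_add// integral_dirac// diracE mem_set ?mul1e//.
    by rewrite /D/= in_itv/= lexx ltW.
  by move=> A mA AD; rewrite -[LHS]/(lambda_delta h A) /lambda_delta /mrestr setIidl.
have xN : (`|x|%:E = 'N[lambda_delta h]_2[EFin \o L2_fun x])%E.
  exact: (finite_norm_fine (L2_rep x)).
have N2 : ((`|x| ^+ 2)%:E = \int[lambda_delta h]_t F t)%E.
  rewrite -powR_mulrn// -poweR_EFin xN poweR_Lnorm//.
  apply: eq_integral => t _ /=.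
  by rewrite -[LHS]/((`|L2_fun x t| `^ 2)%:E) powR_mulrn// /F real_normK// num_real.
have ILfin : (\int[lebesgue_measure]_(t in D) F t)%E \is a fin_num.
  rewrite ge0_fin_numE ?integral_ge0//.
  apply: (@le_lt_trans _ _ (`|x| ^+ 2)%:E); last exact: ltry.
  by rewrite N2 I leeDl// lee_fin sqr_ge0.
rewrite -[LHS]ger0_norm// -sqrtr_sqr; congr Num.sqrt.
by apply/EFin_inj; rewrite N2 I EFinD /Rintegral fineK.
Qed.

Lemma rho_bounded h u : 0 < h ->
  exists M, forall x : H h, `|rho u x| <= M * `|x|.
Proof.
move=> h0; pose e : H h := L2_class (Lfun_Sub (lee1n 2) (rho_fun_Lfun h u 1)).
exists `|e| => x.
have -> : rho u x = L2_fun x h *: e.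
  apply: L2_ext; apply: filterS3 (L2_scaleE (L2_fun x h) e)
    (L2_classE (Lfun_Sub (lee1n 2) (rho_fun_Lfun h u 1)))
    (L2_classE (Lfun_Sub (lee1n 2) (rho_fun_Lfun h u (L2_fun x h)))) => t.
  by move=> -> -> ->; rewrite /= /rho_fun; ring.
rewrite normrZ mulrC ler_wpM2l// H_normE// -sqrtr_sqr ler_wsqrtr// lerDr.
by apply: Rintegral_ge0 => t _; exact: sqr_ge0.
Qed.

End autoregression_operator.
Arguments rho {R} h u x.

Section processes.
Context {d : measure_display} {Omega : measurableType d} {R : realType}.
Variable P : probability Omega R.

(* In the library, normal_prob m 0 is a uniform law, not the Dirac mass at m. *)
Definition gaussian_law (m s : R) : set R -> \bar R :=
  if s == 0 then dirac m else normal_prob m s.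

Definition gaussian_rv (X : Omega -> R) : Prop :=
  exists m s : R, forall A : set R, measurable A ->
    P (X @^-1` A) = gaussian_law m s A.

Definition gaussian_process (X : R -> {RV P >-> R}) : Prop :=
  forall (n : nat) (t c : 'I_n -> R),
    gaussian_rv (fun w => \sum_(i < n) c i * X (t i) w).

Record two_sided_wiener (W : R -> {RV P >-> R}) : Prop := {
  wiener0 : {ae P, forall w, W 0 w = 0} ;
  wiener_continuous : forall w, continuous (fun t => W t w) ;
  wiener_increment : forall s t : R, s < t ->
    forall A : set R, measurable A ->
      P [set w | A (W t w - W s w)] = normal_prob 0 (Num.sqrt (t - s)) A ;
  wiener_independent : forall (n : nat) (t : nat -> R),
    {homo t : i j / (i <= j)%N >-> i <= j} ->
    forall A : nat -> set R, (forall i, measurable (A i)) ->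
      P (\bigcap_(i in `I_n) [set w | A i (W (t i.+1) w - W (t i) w)]) =
      (\prod_(i < n) P [set w | A i (W (t i.+1) w - W (t i) w)%R])%E }.

(* (c, (a, b)), with a <= b, stands for c times the indicator function of      *)
(* ]a, b].                                                                     *)
Definition step_fun (phi : seq (R * (R * R))) (s : R) : R :=
  \sum_(p <- phi) p.1 * \1_`]p.2.1, p.2.2]%classic s.

Definition step_integral (W : R -> {RV P >-> R}) (phi : seq (R * (R * R)))
  (w : Omega) : R := \sum_(p <- phi) p.1 * (W p.2.2 w - W p.2.1 w).

(* X is the L^2(P)-limit of the integrals against dW of step functions that    *)
(* converge to f in L^2(R). By isometry, every such sequence of step functions *)
(* yields the same limit.                                                      *)
Definition is_wiener_integral (W : R -> {RV P >-> R}) (f : R -> R)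
    (X : Omega -> R) : Prop :=
  exists phi : nat -> seq (R * (R * R)),
    [/\ forall k, all (fun p => p.2.1 <= p.2.2) (phi k),
        (\int[lebesgue_measure]_s ((step_fun (phi k) s - f s) ^+ 2)%R%:E)%E
          @[k --> \oo] --> 0%E
      & (\int[P]_w ((step_integral W (phi k) w - X w) ^+ 2)%R%:E)%E
          @[k --> \oo] --> 0%E].

(* Stationarity is not a separate field: a centered Gaussian process whose     *)
(* covariance depends only on t - s is stationary. When W is a two-sided       *)
(* Wiener process, the last three fields are consequences of ou_integral.      *)
Record ornstein_uhlenbeck (W : R -> {RV P >-> R}) (theta : R)
    (xi : R -> {RV P >-> R}) : Prop := {
  ou_integral : forall t, is_wiener_integral W
    (fun s => if s <= t then expR (- theta * (t - s)) else 0) (xi t) ;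
  ou_continuous : forall w, continuous (fun t => xi t w) ;
  ou_gaussian : gaussian_process xi ;
  ou_centered : forall t, ('E_P[xi t] = 0)%E ;
  ou_covariance : forall s t, covariance P (xi s) (xi t) =
    ((2 * theta)^-1 * expR (- theta * `|t - s|))%:E }.

Definition mle (xi : R -> {RV P >-> R}) (T : R) (w : Omega) : R :=
  (1 + xi 0 w ^+ 2 / T - xi T w ^+ 2 / T) /
  (2 / T * \int[lebesgue_measure]_(t in `[0, T]) (xi t w ^+ 2)).

End processes.
Arguments two_sided_wiener {d Omega R} P W.
Arguments ornstein_uhlenbeck {d Omega R} P W theta xi.

(* Main.v *)
(* Strong consistency of the maximum likelihood estimator reduces to the law of
   large numbers (1/T) int_0^T xi_t^2 dt -> 1/(2 theta) and to xi_T^2/T -> 0,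
   since |exp(- theta t) - exp(- u t)| <= exp(|theta - u| h) - 1 on [0, h] then
   controls the operator norm. For a centered Gaussian pair (X, Y), Isserlis'
   formula E[X^2 Y^2] = E[X^2] E[Y^2] + 2 E[X Y]^2 gives
   Cov(xi_s^2, xi_t^2) = exp(- 2 theta |t - s|) / (2 theta^2), so the variance of
   int_0^T xi_t^2 dt is O(T). Hence the averages converge almost surely along
   T = m^2 h, where the variances are summable, and the monotonicity of
   T |-> int_0^T xi_t^2 dt fills the gaps between consecutive squares. *)

Require Import Defs.
From HB Require Import structures.
From mathcomp Require Import all_boot all_order all_algebra.
From mathcomp Require Import all_classical all_reals all_analysis.
From mathcomp Require Import measurable_realfun.
From mathcomp Require Import ring lra.

Set Implicit Arguments.
Unset Strict Implicit.
Unset Printing Implicit Defensive.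

Import Order.TTheory GRing.Theory Num.Theory.
Import numFieldNormedType.Exports.

Local Open Scope classical_set_scope.
Local Open Scope ring_scope.

(** * Moments of the normal distribution *)

Section normal_moments.
Context {R : realType}.
Local Notation mu := (@lebesgue_measure R).
Implicit Types m s x : R.

(** The explicit density and the Radon-Nikodym derivative have the same integral over every
    measurable set, so they agree almost everywhere and the change of variables for the latter
    applies to the former. *)
Lemma ge0_integral_normal_prob m s (f : R -> \bar R) :
  (forall x, (0 <= f x)%E) -> measurable_fun [set: measurableTypeR R] f ->
  (\int[normal_prob m s]_x f x = \int[mu]_x (f x * (normal_pdf m s x)%:E))%E.
Proof.
move=> f0 mf; have dom := @normal_prob_dominates R m s.
have mpdf := @measurable_normal_pdf R m s.
rewrite -(Radon_Nikodym_SigmaFinite.change_of_variables dom)//.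
apply: ae_eq_integral => //.
- apply: emeasurable_funM => //.
  exact: measurable_int (Radon_Nikodym_SigmaFinite.f_integrable dom).
- by apply: emeasurable_funM => //; exact/measurable_EFinP.
apply: filterS (@integral_ae_eq _ _ _ mu setT measurableT
  (EFin \o normal_pdf m s)
  (Radon_Nikodym_SigmaFinite.f (normal_prob m s) mu) _ _ _).
- by move=> x /= + _ => <-.
- exact: Radon_Nikodym_SigmaFinite.f_integrable.
- exact/measurable_EFinP.
- by move=> E _ mE; rewrite -Radon_Nikodym_SigmaFinite.f_integral.
Qed.

Lemma is_derive_normal_pdf s x : s != 0 ->
  is_derive x 1 (normal_pdf 0 s) (- (x / s ^+ 2) * normal_pdf 0 s x).
Proof.
move=> s0; rewrite normal_pdfE// /normal_fun.
have -> : (fun x : R => normal_peak s * expR (- (x - 0) ^+ 2 / (s ^+ 2 *+ 2))) =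
   (fun x : R => normal_peak s *: expR ((- (s ^+ 2 *+ 2)^-1) *: x ^+ 2)).
  apply/funext => y; rewrite subr0 /GRing.scale/=; congr (_ * expR _).
  by rewrite !mulNr mulrC.
apply: is_derive_eq.
rewrite /GRing.scale/= subr0.
have -> : - (s ^+ 2 *+ 2)^-1 * x ^+ 2 = - x ^+ 2 / (s ^+ 2 *+ 2).
  by rewrite !mulNr mulrC.
by field.
Qed.

(** With y = a^2 / (2 s^2), the bound e^y >= y^(k+1) / (k+1)! makes a^k e^(-y) at most a constant
    over a, for every integer a >= 1. This controls the boundary terms of the integrations by
    parts. *)
Lemma cvg_exprM_normal_pdf s k : s != 0 ->
  (n%:R : R) ^+ k * normal_pdf 0 s n%:R @[n --> \oo] --> 0.
Proof.
move=> s0; rewrite -cvg_shiftS.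
have s2 : 0 < s ^+ 2 *+ 2 by rewrite pmulrn_lgt0// exprn_even_gt0.
pose C := normal_peak s * (k.+1`!%:R * (s ^+ 2 *+ 2) ^+ k.+1).
apply: (@squeeze_cvgr _ _ _ _ (cst 0) (fun n => C * n.+1%:R^-1)).
- apply: nearW => n; rewrite mulr_ge0 ?normal_pdf_ge0//=.
  rewrite normal_pdfE// /normal_fun subr0 mulNr expRN.
  rewrite mulrCA /C -mulrA ler_wpM2l ?normal_peak_ge0//.
  set a : R := n.+1%:R; set y := a ^+ 2 / _.
  have a0 : 0 < a by rewrite ltr0n.
  have y0 : 0 < y by rewrite divr_gt0// exprn_gt0.
  rewrite ler_pdivrMr ?expR_gt0//.
  apply: (@le_trans _ _ (k.+1`!%:R * (s ^+ 2 *+ 2) ^+ k.+1 / a *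
    (y ^+ k.+1 / k.+1`!%:R))); last first.
    rewrite ler_wpM2l//; last by apply: (le_trans _ (expR_ge1Dxn k (ltW y0))); rewrite lerDr.
    by rewrite divr_ge0 ?mulr_ge0 ?exprn_ge0 ?ltW.
  rewrite /y expr_div_n -exprM.
  have -> : k.+1`!%:R * (s ^+ 2 *+ 2) ^+ k.+1 / a *
    (a ^+ (2 * k.+1) / (s ^+ 2 *+ 2) ^+ k.+1 / k.+1`!%:R) = a ^+ (k + k.+1).
    have -> : (2 * k.+1 = (k + k.+1).+1)%N by rewrite mul2n -addnn addSn.
    rewrite (exprS a); have : (s ^+ 2 *+ 2) ^+ k.+1 != 0 by rewrite expf_neq0// gt_eqF.
    have : k.+1`!%:R != 0 :> R by rewrite pnatr_eq0 -lt0n fact_gt0.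
    move: (_ ^+ (k + _)) (_ ^+ k.+1) (_`!%:R) (gt_eqF a0) => u v w /negbT a1 w1 v1.
    by clearbody a; field; rewrite a1 w1 v1.
  rewrite ler_weXn2l ?leq_addr// ler1n//.
- exact: cvg_cst.
- rewrite -(mulr0 C); apply: cvgM; [exact: cvg_cst|exact: cvg_harmonic].
Qed.

Lemma is_derive_LRcontinuous (F f : R -> R) (a b : R) :
  (forall x, is_derive x 1 F (f x)) ->
  derivable_oo_LRcontinuous F a b /\ {in `]a, b[, F^`()%classic =1 f}.
Proof.
move=> dF; have cF : continuous F.
  by move=> x; apply: differentiable_continuous; apply/derivable1_diffP; case: (dF x).
split; last by move=> x _; rewrite derive1E; case: (dF x).
split; [by move=> x _; case: (dF x)|exact/cvg_at_right_filter/cF|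
        exact/cvg_at_left_filter/cF].
Qed.

(** Integration by parts on [0, n] of x^(k+1) against x times the density; the boundary term is zero
    at 0 and tends to 0 at n, and the integrals over [0, n] converge monotonically. *)
Lemma normal_half_moment_rec s k : s != 0 -> ~~ odd k ->
  (\int[mu]_(x in `[0%R, +oo[) (x ^+ k * normal_pdf 0 s x)%:E)%E \is a fin_num ->
  (\int[mu]_(x in `[0%R, +oo[) (x ^+ k.+2 * normal_pdf 0 s x)%:E =
   (s ^+ 2 * k.+1%:R)%:E *
     \int[mu]_(x in `[0%R, +oo[) (x ^+ k * normal_pdf 0 s x)%:E)%E.
Proof.
move=> s0 evk fin.
have ge0 j x : ~~ odd j -> 0 <= x ^+ j * normal_pdf 0 s x.
  by move=> ej; rewrite mulr_ge0 ?normal_pdf_ge0// exprn_even_ge0.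
have cont j : continuous (fun x : R => x ^+ j * normal_pdf 0 s x).
  move=> x; apply: cvgM; first exact: exprn_continuous.
  exact: continuous_normal_pdf.
have meas j : measurable_fun [set: R] (fun x : R => x ^+ j * normal_pdf 0 s x).
  by apply: continuous_measurable_fun.
have evk2 : ~~ odd k.+2 by rewrite /= negbK.
have A : (- s ^+ 2 * (n%:R ^+ k.+1 * normal_pdf 0 s n%:R))%:E @[n --> \oo] --> (0 : R)%:E.
  apply: cvg_EFin; first exact: nearW.
  rewrite -[X in _ --> X](mulr0 (- s ^+ 2)); apply: cvgM; first exact: cvg_cst.
  exact: cvg_exprM_normal_pdf.
have B := cvgeZl (isT : (s ^+ 2 * k.+1%:R)%:E \is a fin_num)
  (@ge0_cvgn_integral R mu _ (fun x => ge0 k x evk) (meas _)).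
have D : (0%:E +? ((s ^+ 2 * k.+1%:R)%:E * \int[mu]_(x in `[0%R, +oo[)
    (x ^+ k * normal_pdf 0 s x)%:E))%E by exact: fin_num_adde_defr.
have /cvg_lim <-// := @ge0_cvgn_integral R mu _ (fun x => ge0 k.+2 x evk2) (meas _).
apply/cvg_lim => //; have := cvgeD D A B; rewrite add0e.
move=> h; apply: (cvg_trans _ (h _)); apply: near_eq_cvg; near=> n.
have n0 : 0 < n%:R :> R by rewrite ltr0n; near: n; exact: nbhs_infty_gt.
have dX x : is_derive x (1 : R) (fun y : R => y ^+ k.+1) (k.+1%:R * x ^+ k).
  by apply: DeriveDef; [exact: exprn_derivable|rewrite exp_derive /GRing.scale/= mulr1].
(* Since the density p satisfies p' = - (x / s^2) p, an antiderivative of x p is - s^2 p. *)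
have dG x : is_derive x (1 : R) (fun y => - s ^+ 2 * normal_pdf 0 s y) (x * normal_pdf 0 s x).
  have dpdf := is_derive_normal_pdf x s0.
  rewrite (_ : (fun y => _) = (- s ^+ 2) *: normal_pdf 0 s)//.
  by apply: is_derive_eq; rewrite /GRing.scale/=; field.
have [LF EF] := is_derive_LRcontinuous 0 n%:R dX.
have [LG EG] := is_derive_LRcontinuous 0 n%:R dG.
have := integration_by_parts n0 _ LF EF _ LG EG.
rewrite expr0n/= mul0r subr0 => P.
transitivity (\int[mu]_(x in `[0%R, n%:R%R]) (x ^+ k.+1 * (x * normal_pdf 0 s x))%:E)%E; last first.
  by apply: eq_integral => x _; rewrite mulrA -exprSr.
rewrite P; last 2 first.
- apply: continuous_subspaceT => x; apply: cvgM; first exact: cvg_cst.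
  exact: exprn_continuous.
- apply: continuous_subspaceT => x; apply: cvgM; first exact: cvg_id.
  exact: continuous_normal_pdf.
rewrite [X in X%:E]mulrCA; congr (_ + _)%E.
rewrite -ge0_integralZl//=; first last.
- by rewrite lee_fin mulr_ge0// sqr_ge0.
- by move=> x _; rewrite lee_fin ge0.
- by apply/measurable_EFinP; apply: measurable_funTS; exact: meas.
rewrite -[LHS]oppeK; congr (- _)%E; rewrite -integral_ge0N//=; last first.
  by move=> x _; rewrite -EFinM lee_fin mulr_ge0 ?ge0// mulr_ge0// sqr_ge0.
by apply: eq_integral => x _; congr _%:E; ring.

Unshelve. all: by end_near.
Qed.

Lemma normal_momentE s k : s != 0 -> ~~ odd k ->
  (\int[mu]_x (x ^+ k * normal_pdf 0 s x)%:E =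
  2%:E * \int[mu]_(x in `[0%R, +oo[) (x ^+ k * normal_pdf 0 s x)%:E)%E.
Proof.
move=> s0 evk; rewrite set_itvcy ge0_symfun_integralT//=.
- by move=> x; rewrite mulr_ge0 ?normal_pdf_ge0// exprn_even_ge0.
- move=> x; apply: cvgM; first exact: exprn_continuous.
  exact: continuous_normal_pdf.
- move=> x /=; rewrite exprNn -signr_odd (negbTE evk) mul1r.
  by rewrite !normal_pdfE// /normal_fun !subr0 sqrrN.
Qed.

Lemma normal_moment_rec s k : s != 0 -> ~~ odd k ->
  (\int[mu]_x (x ^+ k * normal_pdf 0 s x)%:E)%E \is a fin_num ->
  (\int[mu]_x (x ^+ k.+2 * normal_pdf 0 s x)%:E =
  (s ^+ 2 * k.+1%:R)%:E * \int[mu]_x (x ^+ k * normal_pdf 0 s x)%:E)%E.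
Proof.
move=> s0 evk fin; rewrite !normal_momentE//= ?negbK//.
rewrite normal_half_moment_rec//; first by rewrite muleCA.
move: fin; rewrite normal_momentE// ge0_fin_numE; last first.
  rewrite mule_ge0// integral_ge0// => x _.
  by rewrite lee_fin mulr_ge0 ?normal_pdf_ge0// exprn_even_ge0.
rewrite ge0_fin_numE; last first.
  rewrite integral_ge0// => x _.
  by rewrite lee_fin mulr_ge0 ?normal_pdf_ge0// exprn_even_ge0.
(* An infinite half-line integral would make its double infinite, so finiteness on the line passes
   to the half-line. *)
by apply: contraTT; rewrite -!leNgt !leye_eq => /eqP ->; rewrite gt0_muley.
Qed.

Lemma normal_moment0 s : (\int[mu]_x (x ^+ 0 * normal_pdf 0 s x)%:E = 1)%E.
Proof. by under eq_integral do rewrite mul1r; exact: integral_normal_pdf. Qed.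

Lemma normal_moment2 s : s != 0 ->
  (\int[mu]_x (x ^+ 2 * normal_pdf 0 s x)%:E = (s ^+ 2)%:E)%E.
Proof. by move=> s0; rewrite normal_moment_rec// normal_moment0// mule1 mulr1. Qed.

Lemma normal_moment4 s : s != 0 ->
  (\int[mu]_x (x ^+ 4 * normal_pdf 0 s x)%:E = (3 * s ^+ 4)%:E)%E.
Proof.
move=> s0; rewrite normal_moment_rec// normal_moment2//.
by rewrite -EFinM; congr _%:E; ring.
Qed.

(** Translation by [m] brings every normal law back to the centered one, whose moments are known. *)
Lemma integral_normal_pdf_shift m s (f : R -> R) : s != 0 ->
  continuous f -> (forall x, 0 <= f x) ->
  (\int[mu]_x (f (x - m) * normal_pdf m s x)%:E =
   \int[mu]_x (f x * normal_pdf 0 s x)%:E)%E.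
Proof.
move=> s0 cf f0.
have dF : (fun x : R => x - m)^`()%classic = cst 1.
  apply/funext => x; rewrite derive1E deriveB//.
  by rewrite derive_id derive_cst subr0.
rewrite (@increasing_ge0_integration_by_substitutionT _ (fun x => x - m)
  (fun x => f x * normal_pdf 0 s x)).
- apply: eq_integral => x _; rewrite dF /= fctE /= mulr1 !normal_pdfE//.
  by rewrite /normal_fun subr0.
- by move=> x y xy; rewrite ltrD2r.
- by rewrite dF => ?; exact: cvg_cst.
- by rewrite dF; exact: is_cvg_cst.
- by rewrite dF; exact: is_cvg_cst.
- by move=> x; exact: derivableB.
- exact: cvg_addrr_Ny.
- exact: cvg_addrr.
- by move=> x; apply: cvgM; [exact: cf|exact: continuous_normal_pdf].
- by move=> x; rewrite mulr_ge0// normal_pdf_ge0.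
Qed.

Lemma ge0_integralT_split0 (f : R -> R) :
  continuous f -> (forall x, 0 <= f x) ->
  (\int[mu]_x (f x)%:E = \int[mu]_(x in `]-oo, 0%R]) (f x)%:E +
                         \int[mu]_(x in `[0%R, +oo[) (f x)%:E)%E.
Proof.
move=> cf f0; have mf : measurable_fun [set: R] f by exact: continuous_measurable_fun.
have mposnums : measurable [set x : R | 0 <= x]%R by rewrite -set_itvcy.
rewrite -(setUv [set x : R | 0 <= x]%R) ge0_integral_setU//= ; last 4 first.
  exact: measurableC.
  by apply/measurable_EFinP; rewrite setUv.
  by move=> x _; rewrite lee_fin.
  exact/disj_setPCl.
rewrite -set_itvcy// setCitvr addeC; congr +%E.
by rewrite integral_itv_bndo_bndc//; exact/measurable_EFinP/measurable_funTS.
Qed.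

Lemma ge0_integralT_opp (f : R -> R) :
  continuous f -> (forall x, 0 <= f x) ->
  (\int[mu]_x (f (- x))%:E = \int[mu]_x (f x)%:E)%E.
Proof.
move=> cf f0.
have cfN : continuous (f \o -%R).
  by move=> x; apply: continuous_comp; [exact: opp_continuous|exact: cf].
have -> := ge0_integralT_split0 cf f0.
have /= -> := ge0_integralT_split0 cfN (fun x => f0 (- x)).
have N (g : R -> R) : continuous g -> (forall x, 0 <= g x) ->
    (\int[mu]_(x in `]-oo, 0%R]) (g x)%:E = \int[mu]_(x in `[0%R, +oo[) (g (- x))%:E)%E.
  move=> cg g0; rewrite -{1}oppr0 ge0_integration_by_substitutionNy//.
  exact: continuous_subspaceT.
rewrite addeC (N f)// (N (f \o -%R))//=; congr (_ + _)%E.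
by apply: eq_integral => x _; rewrite opprK.
Qed.

(** The density is even, so x -> - x exchanges the two parts. This expresses that the first moment
    vanishes while only nonnegative functions are integrated. *)
Lemma integral_normal_pos_neg_part s : s != 0 ->
  (\int[mu]_x (Num.max x 0 * normal_pdf 0 s x)%:E =
   \int[mu]_x (Num.max (- x) 0 * normal_pdf 0 s x)%:E)%E.
Proof.
move=> s0; rewrite -[LHS]ge0_integralT_opp.
- apply: eq_integral => x _; rewrite !normal_pdfE//.
  by rewrite /normal_fun !subr0 sqrrN.
- move=> x; apply: cvgM; last exact: continuous_normal_pdf.
  by apply: continuous_max; [exact: cvg_id|exact: cvg_cst].
- by move=> x; rewrite mulr_ge0 ?normal_pdf_ge0// le_max lexx orbT.
Qed.

End normal_moments.

(** * Fourth moment of a centered Gaussian variable *)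

Section gaussian_moment4.
Context {d : measure_display} {Omega : measurableType d} {R : realType}.
Variable P : probability Omega R.
Local Notation mu := (@lebesgue_measure R).

(** The same [m] and [s] serve all test functions, so that several moments can be compared; the case
    [s = 0] is the Dirac mass of [gaussian_law]. *)
Lemma gaussian_rv_integral (Z : Omega -> R) : measurable_fun setT Z -> gaussian_rv P Z ->
  exists m s : R, forall f : R -> R, continuous f -> (forall x, 0 <= f x) ->
  (\int[P]_w (f (Z w - m))%:E =
   if s == 0%R then (f 0%R)%:E else \int[mu]_x (f x * normal_pdf 0 s x)%:E)%E.
Proof.
move=> mZ [m [s law]]; exists m, s => f cf f0.
pose X : {RV P >-> measurableTypeR R} := HB.pack (Z : Omega -> measurableTypeR R)
  (isMeasurableFun.Build _ _ _ (measurableTypeR R) _ mZ).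
have mf : measurable_fun setT (fun x : measurableTypeR R => (f (x - m))%:E).
  apply/measurable_EFinP; apply: continuous_measurable_fun => x.
  apply: (@continuous_comp _ _ _ (fun x : R => x - m) f); last exact: cf.
  by apply: cvgB; [exact: cvg_id|exact: cvg_cst].
transitivity (\int[distribution P X]_x (f (x - m))%:E)%E.
  by rewrite ge0_integral_distribution// => x; rewrite lee_fin.
have [s0|s0] := eqVneq s 0.
  transitivity (\int[\d_(m : measurableTypeR R)]_x (f (x - m))%:E)%E.
    apply: eq_measure_integral => A mA _.
    by rewrite /= /distribution /pushforward law// /gaussian_law s0 eqxx.
  by rewrite integral_dirac// diracT mul1e subrr.
transitivity (\int[normal_prob m s]_x (f (x - m))%:E)%E.
  apply: eq_measure_integral => A mA _.
  by rewrite /= /distribution /pushforward law// /gaussian_law (negbTE s0).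
rewrite ge0_integral_normal_prob//; last by move=> x; rewrite lee_fin.
by rewrite -(integral_normal_pdf_shift m)//; apply: eq_integral => x _; rewrite EFinM.
Qed.

(** The parameters of the law are only known to exist: the first moment forces [m = 0], the second
    forces s^2 = v, and the fourth is then 3 s^4. *)
Lemma gaussian_moment4 (Z : Omega -> R) (v : R) : measurable_fun setT Z -> gaussian_rv P Z ->
  P.-integrable setT (EFin \o Z) -> (\int[P]_w (Z w)%:E = 0)%E ->
  (\int[P]_w (Z w ^+ 2)%:E = v%:E)%E ->
  (\int[P]_w (Z w ^+ 4)%:E = (3 * v ^+ 2)%:E)%E.
Proof.
move=> mZ gZ iZ EZ EZ2.
have [m [s E]] := gaussian_rv_integral mZ gZ.
have iY : P.-integrable setT (EFin \o (fun w => Z w - m)).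
  exact: (integrableB measurableT iZ (finite_measure_integrable_cst P m measurableT)).
(* By symmetry the positive and negative parts of Z - m have equal integrals, so E[Z - m] = 0 while
   E[Z] = 0. *)
have m0 : m = 0.
  have : (\int[P]_w (Z w - m)%:E = 0)%E.
    rewrite integralE.
    have -> : (\int[P]_x ((fun w => (Z w - m)%:E)^\+ x) = \int[P]_w (Num.max (Z w - m)%R 0%R)%:E)%E.
      by apply: eq_integral => w _; rewrite funeposE EFin_max.
    have -> : (\int[P]_x ((fun w => (Z w - m)%:E)^\- x) =
        \int[P]_w (Num.max (- (Z w - m))%R 0%R)%:E)%E.
      by apply: eq_integral => w _; rewrite funenegE EFin_max.
    have cmax (g : R -> R) : continuous g -> continuous (fun x => Num.max (g x) 0).
      by move=> cg x; apply: continuous_max; [exact: cg|exact: cvg_cst].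
    have max0 (x : R) : 0 <= Num.max x 0 by rewrite le_max lexx orbT.
    rewrite (E (fun x => Num.max x 0)) ?(E (fun x => Num.max (- x) 0))//;
      [|exact/cmax/opp_continuous|by apply/cmax => x; exact: cvg_id].
    have [s0|s0] := eqVneq s 0; first by rewrite oppr0 subee.
    rewrite integral_normal_pos_neg_part// subee//.
    (* The common value is finite because Z - m is integrable; this makes the difference 0 rather
       than indeterminate. *)
    have := E (fun x => Num.max (- x) 0).
    rewrite (negbTE s0) => <-//; last exact/cmax/opp_continuous.
    have -> : (\int[P]_w (Num.max (- (Z w - m))%R 0%R)%:E =
        \int[P]_x ((fun w => (Z w - m)%:E)^\- x))%E.
      by apply: eq_integral => w _; rewrite funenegE EFin_max.
    exact/integrable_fin_num/integrable_funeneg.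
  under eq_integral do rewrite EFinB.
  rewrite integralB_EFin//; last exact: finite_measure_integrable_cst.
  have EC : (\int[P]_w m%:E = m%:E)%E.
    by rewrite integral_cst//= probability_setT mule1.
  rewrite EZ add0e EC.
  by case=> /eqP; rewrite oppr_eq0 => /eqP.
move: E; rewrite m0 => E.
have EX k : ~~ odd k -> (\int[P]_w (Z w ^+ k)%:E =
    if s == 0%R then (0 ^+ k)%:E else \int[mu]_x (x ^+ k * normal_pdf 0 s x)%:E)%E.
  move=> evk; rewrite -E; last 2 first.
  - exact: exprn_continuous.
  - by move=> x; exact: exprn_even_ge0.
  by apply: eq_integral => w _; rewrite subr0.
move: EZ2; rewrite !EX//; have [s0|s0] := eqVneq s 0.
  by move=> h; rewrite -(EFin_inj h) !expr0n/= mulr0.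
by rewrite normal_moment2// normal_moment4// => -[<-]; rewrite -exprM.
Qed.
End gaussian_moment4.

(** * Calculus of means and Isserlis' formula *)

Section has_mean.
Context {d : measure_display} {Omega : measurableType d} {R : realType}.
Variable P : probability Omega R.
Implicit Types (f g X Y : Omega -> R) (a b v : R).

(** Integrability and the value travel together, so that linear combinations leave no integrability
    side condition. *)
Definition has_mean f v := P.-integrable setT (EFin \o f) /\
  (\int[P]_w (f w)%:E = v%:E)%E.

Lemma has_mean_cst a : has_mean (cst a) a.
Proof.
split; first exact: finite_measure_integrable_cst.
have -> : (fun w => (cst a w)%:E) = cst a%:E by [].
by rewrite integral_cst//= probability_setT mule1.
Qed.

Lemma has_meanD f g a b :
  has_mean f a -> has_mean g b -> has_mean (fun w => f w + g w) (a + b).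
Proof.
move=> [fi fa] [gi gb]; split; first exact: (integrableD measurableT fi gi).
by under eq_integral do rewrite EFinD; rewrite integralD_EFin// fa gb.
Qed.

Lemma has_meanZ k f a : has_mean f a -> has_mean (fun w => k * f w) (k * a).
Proof.
move=> [fi fa]; split; first exact: (integrableZl measurableT k fi).
by under eq_integral do rewrite EFinM; rewrite integralZl// fa.
Qed.

Lemma has_meanB f g a b :
  has_mean f a -> has_mean g b -> has_mean (fun w => f w - g w) (a - b).
Proof.
move=> fa gb; have := has_meanD fa (has_meanZ (-1) gb).
by rewrite mulN1r; under eq_fun do rewrite mulN1r.
Qed.

Lemma has_mean_sum n (F : 'I_n -> Omega -> R) (a : 'I_n -> R) :
  (forall i, has_mean (F i) (a i)) ->
  has_mean (fun w => \sum_(i < n) F i w) (\sum_(i < n) a i).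
Proof.
elim: n F a => [|n IH] F a Fa.
  under eq_fun do rewrite big_ord0.
  by rewrite big_ord0; exact: has_mean_cst.
under eq_fun do rewrite big_ord_recr/=.
by rewrite big_ord_recr/=; apply: has_meanD => //; exact: (IH (fun i => F (widen_ord _ i))).
Qed.

Lemma ge0_has_mean f v : measurable_fun setT f -> (forall w, 0 <= f w) ->
  (\int[P]_w (f w)%:E = v%:E)%E -> has_mean f v.
Proof.
move=> mf f0 fv; split => //; apply/integrableP; split; first exact/measurable_EFinP.
under eq_integral do rewrite /= ger0_norm//.
by rewrite fv ltry.
Qed.

(** Domination by 1 + X^2, which is integrable under a probability: |X| <= X^2 + 1/4 follows from
    (|X| - 1/2)^2 >= 0. *)
Lemma sqr_integrable X : measurable_fun setT X ->
  P.-integrable setT (EFin \o (fun w => X w ^+ 2)) -> P.-integrable setT (EFin \o X).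
Proof.
move=> mX iX2.
have i1 := integrableD measurableT (finite_measure_integrable_cst P 1 measurableT) iX2.
apply: le_integrable i1 => //; first exact/measurable_EFinP.
move=> w _ /=; rewrite lee_fin [leRHS]ger0_norm; last by rewrite addr_ge0 ?sqr_ge0.
rewrite -[X w ^+ 2]real_normK ?num_real// -subr_ge0.
have := sqr_ge0 (`|X w| - 2^-1); lra.
Qed.

Section isserlis.
Variables (X Y : Omega -> R) (a b c : R).
Hypotheses (mX : measurable_fun setT X) (mY : measurable_fun setT Y).
Hypothesis gXY : forall k l : R, gaussian_rv P (fun w => k * X w + l * Y w).
Hypotheses (EX : has_mean X 0) (EY : has_mean Y 0).
Hypotheses (EX2 : has_mean (fun w => X w ^+ 2) a) (EY2 : has_mean (fun w => Y w ^+ 2) b).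
Hypothesis EXY : has_mean (fun w => X w * Y w) c.

(** k X + l Y is a centered Gaussian variable, and k^2 a + l^2 b + 2 k l c is its variance. *)
Lemma gaussian_combination_moment4 (k l : R) :
  has_mean (fun w => (k * X w + l * Y w) ^+ 4)
    (3 * (k ^+ 2 * a + l ^+ 2 * b + 2 * k * l * c) ^+ 2).
Proof.
pose S w := k * X w + l * Y w.
have mS : measurable_fun setT S by apply: measurable_funD; exact: measurable_funM.
have [iS ES] : has_mean S 0.
  by have := has_meanD (has_meanZ k EX) (has_meanZ l EY); rewrite !mulr0 addr0.
have [_ ES2] : has_mean (fun w => S w ^+ 2) (k ^+ 2 * a + l ^+ 2 * b + 2 * k * l * c).
  have := has_meanD (has_meanD (has_meanZ (k ^+ 2) EX2) (has_meanZ (l ^+ 2) EY2))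
    (has_meanZ (2 * k * l) EXY).
  congr has_mean; apply/funext => w; rewrite /S; ring.
apply: ge0_has_mean; last exact: gaussian_moment4.
- by apply: measurable_funX.
- by move=> w; rewrite exprn_even_ge0.
Qed.

(* Polarization: 12 X^2 Y^2 = (X + Y)^4 + (X - Y)^4 - 2 X^4 - 2 Y^4. *)
Lemma isserlis : has_mean (fun w => X w ^+ 2 * Y w ^+ 2) (a * b + 2 * c ^+ 2).
Proof.
have M := gaussian_combination_moment4.
have := has_meanZ (12^-1) (has_meanB (has_meanD (M 1 1) (M 1 (-1)))
  (has_meanZ 2 (has_meanD (M 1 0) (M 0 1)))).
congr has_mean; last by field.
by apply/funext => w; field.
Qed.

End isserlis.
End has_mean.

(** * Squares of the Ornstein-Uhlenbeck process *)

Section ornstein_uhlenbeck_squares.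
Context {d : measure_display} {Omega : measurableType d} {R : realType}.
Variable P : probability Omega R.
Variables (W xi : R -> {RV P >-> R}) (theta : R).
Hypothesis theta_gt0 : 0 < theta.
Hypothesis hxi : ornstein_uhlenbeck P W theta xi.
Local Notation sigma2 := ((2 * theta)^-1).
Local Notation cov s t := (sigma2 * expR (- theta * `|t - s|)).

Lemma measurable_ou t : measurable_fun setT (xi t).
Proof. exact: measurable_funPT. Qed.
Local Hint Resolve measurable_ou : core.

Lemma ou_integralM s t : (\int[P]_w (xi s w * xi t w)%:E = (cov s t)%:E)%E.
Proof.
rewrite -(ou_covariance hxi) covariance.unlock !(ou_centered hxi) expectation.unlock.
by apply: eq_integral => w _; rewrite fctE/= !subr0.
Qed.

Lemma ou_moment2 t : has_mean P (fun w => xi t w ^+ 2) sigma2.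
Proof.
apply: ge0_has_mean => [|w|]; [exact: measurable_funX|exact: sqr_ge0|].
have := ou_integralM t t; rewrite subrr normr0 mulr0 expR0 mulr1.
by under eq_integral do rewrite -expr2.
Qed.

Lemma ou_mean t : has_mean P (xi t) 0.
Proof.
split; first by apply: sqr_integrable => //; case: (ou_moment2 t).
by have := ou_centered hxi t; rewrite expectation.unlock.
Qed.

Lemma ou_meanM s t : has_mean P (fun w => xi s w * xi t w) (cov s t).
Proof.
split; last exact: ou_integralM.
have [is2 _] := ou_moment2 s; have [it2 _] := ou_moment2 t.
apply: le_integrable (integrableD measurableT is2 it2) => //.
  by apply/measurable_EFinP; exact: measurable_funM.
move=> w _ /=; rewrite lee_fin [leRHS]ger0_norm ?addr_ge0 ?sqr_ge0//.
(* Both squares (x - y)^2 and (x + y)^2 being nonnegative gives 2 |x y| <= x^2 + y^2. *)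
have := sqr_ge0 (xi s w - xi t w); have := sqr_ge0 (xi s w + xi t w).
by rewrite ler_norml; move=> *; apply/andP; split; nra.
Qed.

(** The times of a Gaussian process need not be distinct, so [s = t] is covered; the fourth moment
    relies on that case. *)
Lemma ou_gaussian2 s t (k l : R) : gaussian_rv P (fun w => k * xi s w + l * xi t w).
Proof.
have := ou_gaussian hxi (fun i : 'I_2 => if i == ord0 then s else t)
  (fun i => if i == ord0 then k else l).
by congr gaussian_rv; apply/funext => w; rewrite big_ord_recr big_ord1.
Qed.

(** Expanding the product, Isserlis' formula contributes sigma2^2 + 2 cov^2 and the remaining terms
    - 2 sigma2^2 + sigma2^2. *)
Lemma ou_sqr_cov s t :
  has_mean P (fun w => (xi s w ^+ 2 - sigma2) * (xi t w ^+ 2 - sigma2))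
    (2 * cov s t ^+ 2).
Proof.
have H := isserlis (measurable_ou s) (measurable_ou t) (ou_gaussian2 s t)
  (ou_mean s) (ou_mean t) (ou_moment2 s) (ou_moment2 t) (ou_meanM s t).
have := has_meanD (has_meanB H (has_meanZ sigma2 (has_meanD (ou_moment2 s) (ou_moment2 t))))
  (has_mean_cst P (sigma2 ^+ 2)).
congr has_mean; last by ring.
by apply/funext => w /=; ring.
Qed.

(** Isserlis' formula at coinciding times, where the covariance is the variance [sigma2]. *)
Lemma ou_moment4 t : has_mean P (fun w => xi t w ^+ 4) (3 * sigma2 ^+ 2).
Proof.
have := isserlis (measurable_ou t) (measurable_ou t) (ou_gaussian2 t t)
  (ou_mean t) (ou_mean t) (ou_moment2 t) (ou_moment2 t) (ou_meanM t t).
rewrite subrr normr0 mulr0 expR0 mulr1; congr has_mean; last by ring.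
by apply/funext => w; rewrite -exprD.
Qed.

End ornstein_uhlenbeck_squares.

(** * Row sums of exponentially decaying covariances *)

Section geometric_rows.
Context {R : realType}.

Lemma geometric_sum_le (q : R) n : 0 <= q < 1 -> \sum_(i < n) q ^+ i <= (1 - q)^-1.
Proof.
move=> /andP[q0 q1]; rewrite -[leRHS]mul1r ler_pdivlMr ?subr_gt0//.
rewrite -[X in _ * X]opprB mulrN mulrC -subrX1 opprB lerBlDr lerDl.
exact: exprn_ge0.
Qed.

(** Cut at j = i, the row is two geometric sums of ratio e^(-y), each at most 1 / (1 - e^(-y)) <= (1
    + y) / y because e^y >= 1 + y. *)
Lemma sum_expR_dist_le (y : R) n (i : 'I_n) : 0 < y ->
  \sum_(j < n) expR (- y * `|j%:R - i%:R|) <= 2 * ((1 + y) / y).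
Proof.
move=> y0; set q := expR (- y).
have q01 : 0 <= q < 1 by rewrite expR_ge0 expR_lt1 oppr_lt0.
have q1 : (1 - q)^-1 <= (1 + y) / y.
  rewrite -[leRHS]invf_div lef_pV2 ?posrE ?subr_gt0 ?divr_gt0 ?addr_gt0//; last by case/andP: q01.
  rewrite lerBrDr -lerBrDl /q expRN.
  rewrite (_ : 1 - y / (1 + y) = (1 + y)^-1); last by field; lra.
  by rewrite lef_pV2 ?posrE ?expR_gt0 ?addr_gt0// expR_ge1Dx.
rewrite (le_trans _ (ler_wpM2l _ q1))//.
rewrite mulr2n mulrDl mul1r -(big_mkord xpredT (fun j => expR (- y * `|j%:R - i%:R|))).
rewrite (big_cat_nat _ (ltnW (ltn_ord i)))//= lerD//.
(* Read backwards from i, the j-th term lies at distance j + 1, and e^(-y (j+1)) <= q^j. *)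
- rewrite big_nat_rev/= add0n big_mkord.
  apply: le_trans (geometric_sum_le i q01); apply: ler_sum => j _.
  rewrite /q -expRM_natr ler_expR !mulNr lerN2 ler_wpM2l ?ltW//.
  have -> : (i - j.+1)%:R - i%:R = - j.+1%:R :> R by rewrite natrB//; ring.
  by rewrite normrN ger0_norm// ltr_nat.
- have := big_addn 0 n i xpredT (fun k => expR (- y * `|k%:R - i%:R|)).
  rewrite add0n => ->; rewrite big_mkord.
  apply: le_trans (geometric_sum_le (n - i) q01); apply: ler_sum => j _.
  by rewrite /q -expRM_natr ler_expR natrD addrK ger0_norm.
Qed.
End geometric_rows.

(** * Second moment of centered Riemann sums *)

Section ou_riemann.
Context {d : measure_display} {Omega : measurableType d} {R : realType}.
Variable P : probability Omega R.
Variables (W xi : R -> {RV P >-> R}) (theta : R).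
Hypothesis theta_gt0 : 0 < theta.
Hypothesis hxi : ornstein_uhlenbeck P W theta xi.
Local Notation sigma2 := ((2 * theta)^-1).
Local Notation cov s t := (sigma2 * expR (- theta * `|t - s|)).

(** The square expands into a double sum of covariances whose rows are bounded independently of N,
    so the bound is linear in the length N delta and stays bounded as the mesh shrinks. *)
Lemma ou_riemann_moment2 (delta : R) (N : nat) : 0 < delta ->
  (\int[P]_w ((delta * \sum_(i < N) (xi (i%:R * delta) w ^+ 2 - sigma2)) ^+ 2)%:E <=
   (N%:R * delta * (2 * sigma2 ^+ 2 * (1 + 2 * theta * delta) / theta))%:E)%E.
Proof.
move=> d0.
have := has_meanZ (delta ^+ 2) (has_mean_sum (fun i : 'I_N => has_mean_sum (fun j : 'I_N =>
  ou_sqr_cov hxi (i%:R * delta) (j%:R * delta)))).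
move=> [_ E].
under eq_integral do rewrite exprMn [X in _ * X]expr2 big_distrlr/=.
rewrite E lee_fin.
(* Squaring the covariance doubles its rate of decay: the rows have y = 2 theta delta. *)
have cov2 (i j : 'I_N) : 2 * cov (i%:R * delta) (j%:R * delta) ^+ 2 =
    2 * sigma2 ^+ 2 * expR (- (2 * theta * delta) * `|j%:R - i%:R|).
  rewrite exprMn -expRM_natr -mulrBl normrM (gtr0_norm d0) -mulrA; congr (_ * (_ * expR _)).
  by ring.
under eq_bigr do under eq_bigr do rewrite cov2.
under eq_bigr do rewrite -mulr_sumr.
rewrite -mulr_sumr.
have y0 : 0 < 2 * theta * delta by rewrite !mulr_gt0.
apply: (@le_trans _ _ (delta ^+ 2 * (2 * sigma2 ^+ 2 *
  \sum_(i < N) (2 * ((1 + 2 * theta * delta) / (2 * theta * delta)))))).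
  apply: ler_wpM2l; first exact: sqr_ge0.
  apply: ler_wpM2l; first by rewrite mulr_ge0 ?sqr_ge0.
  by apply: ler_sum => i _; exact: sum_expR_dist_le.
rewrite sumr_const card_ord -mulr_natr le_eqVlt; apply/orP; left; apply/eqP.
by field; rewrite !gt_eqF.
Qed.

End ou_riemann.

(** * Riemann sums of continuous functions *)

Section riemann_sums.
Context {R : realType}.
Local Notation mu := (@lebesgue_measure R).

(** Heine's theorem by compactness of [a, b]; the second point may leave the segment, as continuity
    holds on the whole line. *)
Lemma continuous_itv_unif (f : R -> R) (a b e : R) : continuous f -> 0 < e ->
  exists2 dl, 0 < dl & forall x y, a <= x <= b -> `|x - y| < dl -> `|f x - f y| < e.
Proof.
move=> cf e0.
have /compact_near_coveringP/(_ R (0 : R)^'+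
  (fun dl x => forall y, `|x - y| < dl -> `|f x - f y| < e) _) H := @segment_compact R a b.
have {H} : \forall dl \near (0 : R)^'+, `[a, b]%classic `<=`
    (fun x => forall y, `|x - y| < dl -> `|f x - f y| < e).
  apply: H => x xab.
  have e2 : 0 < e / 2 by rewrite divr_gt0.
  have /cvgrPdist_lt/(_ _ e2)/nbhs_ballP[r /= r0 Hr] := cf x.
  near=> z dl => y /= zy.
  (* Half the radius for z and half for y keeps both within r of the centre x. *)
  have xz : `|x - z| < r / 2.
    by near: z; apply/nbhs_ballP; exists (r / 2) => //=; rewrite divr_gt0.
  have dr : dl < r / 2 by near: dl; apply: nbhs_right_lt; rewrite divr_gt0.
  have fz : `|f x - f z| < e / 2 by apply: Hr; rewrite /ball/=; lra.
  have fy : `|f x - f y| < e / 2.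
    apply: Hr; rewrite /ball/=; have := ler_distD z x y; lra.
  have := ler_distD (f x) (f z) (f y); rewrite (distrC (f z) (f x)); lra.
move=> H; have [dl dl0 Hdl] : exists2 dl, 0 < dl & `[a, b]%classic `<=`
    (fun x => forall y, `|x - y| < dl -> `|f x - f y| < e).
  near ((0 : R)^'+) => dl; exists dl; first by near: dl; exact: nbhs_right_gt.
  by near: dl.
by exists dl => // x y xab; apply: Hdl; rewrite /= in_itv.
Unshelve. all: by end_near.
Qed.

Lemma continuous_integrable_itv (f : R -> R) (a b : R) : continuous f ->
  mu.-integrable `[a, b] (EFin \o f).
Proof.
move=> cf; apply: continuous_compact_integrable; first exact: segment_compact.
exact: continuous_subspaceT.
Qed.

(** Error of a single left-endpoint rectangle; ]a, b] is the piece added when the segment is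
    extended by one mesh. *)
Lemma Rintegral_segment_cst_dist (f : R -> R) (a b e : R) : continuous f -> a <= b ->
  (forall x, a <= x <= b -> `|f x - f a| <= e) ->
  `|\int[mu]_(x in `]a, b]) f x - (b - a) * f a| <= (b - a) * e.
Proof.
move=> cf ab fe.
have int g : continuous g -> mu.-integrable `]a, b] (EFin \o g).
  move=> cg; apply: integrableS (continuous_integrable_itv a b cg) => //.
  exact: subset_itv_oc_cc.
have cst_int (k : R) : \int[mu]_(x in `]a, b]) k = (b - a) * k.
  rewrite Rintegral_cst// /= lebesgue_measure_itv/= lte_fin.
  case: ltgtP ab => // [ab|->] _; first by rewrite -EFinD/= mulrC.
  by rewrite subrr mulr0 mul0r.
have ccst (k : R) : continuous ((fun=> k) : R -> R) by move=> x; exact: cvg_cst.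
have cB : continuous (fun x => f x - f a).
  by move=> x; apply: cvgB; [exact: cf|exact: cvg_cst].
have cN : continuous (fun x => `|f x - f a|).
  by move=> x; apply: cvg_norm; exact: cB.
rewrite -!cst_int -RintegralB//; [|exact: int|exact: (int _ (ccst _))].
apply: le_trans (le_normr_Rintegral _ (int _ cB)) _ => //.
apply: le_Rintegral => //; [exact: int|exact: (int _ (ccst _))|].
by move=> x /=; rewrite in_itv/= => /andP[/ltW ax xb]; apply: fe; rewrite ax.
Qed.

Lemma riemann_sum_dist (f : R -> R) (delta e : R) (N : nat) : continuous f -> 0 <= delta ->
  (forall x y, 0 <= x <= N%:R * delta -> `|x - y| <= delta -> `|f x - f y| <= e) ->
  `|\int[mu]_(x in `[0, N%:R * delta]) f x - delta * \sum_(i < N) f (i%:R * delta)|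
    <= N%:R * delta * e.
Proof.
move=> cf d0; elim: N => [|N IH] fe.
  by rewrite big_ord0 !mul0r mulr0 subr0 set_itv1 Rintegral_set1 normr0.
have le1 : N%:R * delta <= N.+1%:R * delta by rewrite ler_wpM2r// ler_nat.
have N0 : 0 <= N%:R * delta by rewrite mulr_ge0.
have := @Rintegral_itvB _ f (BLeft 0) (BRight (N.+1%:R * delta)) (N%:R * delta)
  (continuous_integrable_itv _ _ cf).
rewrite !bnd_simp => /(_ N0 le1) E.
have dE : N.+1%:R * delta - N%:R * delta = delta by rewrite -natr1; ring.
have /(Rintegral_segment_cst_dist cf le1) : forall x,
    N%:R * delta <= x <= N.+1%:R * delta -> `|f x - f (N%:R * delta)| <= e.
  move=> x /andP[x1 x2]; rewrite distrC; apply: fe; first by rewrite N0.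
  by rewrite ler_norml; move: dE; lra.
rewrite dE -E => H1.
have {IH} H2 : `|\int[mu]_(x in `[0, N%:R * delta]) f x -
    delta * \sum_(i < N) f (i%:R * delta)| <= N%:R * delta * e.
  by apply: IH => x y /andP[x0 xN]; apply: fe; rewrite x0 (le_trans xN).
rewrite big_ord_recr/= mulrDr.
have -> : N.+1%:R * delta * e = N%:R * delta * e + delta * e by rewrite -natr1; ring.
set A := (X in `|X - _| <= _); set B := (X in `|_ - X - _| <= _) in H1.
have := ler_normD (A - B - delta * f (N%:R * delta))
  (B - delta * \sum_(i < N) f (i%:R * delta)).
rewrite (_ : A - B - _ + _ = A - (delta * \sum_(i < N) f (i%:R * delta) +
  delta * f (N%:R * delta))); last by ring.
rewrite -/A in H1; lra.
Qed.

Lemma cvg_riemann_sum (f : R -> R) (h : R) (n : nat) : continuous f -> 0 < h ->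
  h / k.+1%:R * \sum_(i < n * k.+1) f (i%:R * (h / k.+1%:R)) @[k --> \oo] -->
    \int[mu]_(x in `[0, n%:R * h]) f x.
Proof.
move=> cf h0; apply/cvgrPdist_le => e e0.
have nh0 : 0 <= n%:R * h by rewrite mulr_ge0// ltW.
(* The total error is n h times this tolerance, hence at most e; the added 1 covers n = 0. *)
have e1 : 0 < e / (n%:R * h + 1) by rewrite divr_gt0// ltr_wpDl.
have [dl dl0 Hdl] := continuous_itv_unif 0 (n%:R * h) cf e1.
near=> k.
have k0 : 0 < h / k.+1%:R by rewrite divr_gt0.
have nk : (n * k.+1)%:R * (h / k.+1%:R) = n%:R * h.
  by rewrite natrM; field.
have dk : h / k.+1%:R < dl.
  rewrite ltr_pdivrMr// mulrC -ltr_pdivrMr// -natr1 ltr_wpDr//.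
  by near: k; exact: nbhs_infty_gtr.
have := @riemann_sum_dist f (h / k.+1%:R) (e / (n%:R * h + 1)) (n * k.+1) cf (ltW k0).
rewrite nk => H; apply: le_trans (H _) _ => [x y xn xy|].
  by apply/ltW/Hdl => //; exact: le_lt_trans dk.
rewrite mulrCA; apply: ler_piMr; first exact: ltW.
by rewrite ler_pdivrMr ?ltr_wpDl// mul1r lerDl.
Unshelve. all: by end_near.
Qed.

End riemann_sums.

(** * Almost sure convergence from summable means *)

Section ae_convergence.
Context {d : measure_display} {Omega : measurableType d} {R : realType}.
Variable P : probability Omega R.

(** The series of the [f m] has finite expectation, so it converges almost surely and its terms tend
    to 0. This does the work of Chebyshev's inequality and the Borel-Cantelli lemma. *)
Lemma ae_cvg0_summable (f : nat -> Omega -> R) (K : R) :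
  (forall m, measurable_fun setT (f m)) -> (forall m w, 0 <= f m w) ->
  (forall m, (\int[P]_w (f m w)%:E <= (K / m.+1%:R ^+ 2)%:E)%E) ->
  {ae P, forall w, f m w @[m --> \oo] --> 0}.
Proof.
move=> mf f0 fK.
have f0E m w : (0 <= (f m w)%:E)%E by rewrite lee_fin.
have K0 : 0 <= K.
  have : (0 <= (K / 1%:R ^+ 2)%:E)%E.
    by apply: le_trans (fK 0); exact: integral_ge0.
  by rewrite expr1n divr1.
have mS : measurable_fun setT (fun w => \sum_(0 <= m <oo) (f m w)%:E)%E.
  by apply: ge0_emeasurable_sum => // m _; exact/measurable_EFinP.
have S0 w : (0 <= \sum_(0 <= m <oo) (f m w)%:E)%E by apply: nneseries_ge0.
have fin : (\int[P]_w (\sum_(0 <= m <oo) (f m w)%:E) < +oo)%E.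
  rewrite integral_nneseries//; last by move=> m; exact/measurable_EFinP.
  apply: (@le_lt_trans _ _ (2 * K)%:E); last exact: ltry.
  apply: lime_le.
    by apply: is_cvg_nneseries => m _ _; exact: integral_ge0.
  apply: nearW => n.
  apply: (@le_trans _ _ (\sum_(0 <= m < n) (K / m.+1%:R ^+ 2)%:E)%E).
    exact: lee_sum.
  rewrite sumEFin lee_fin big_mkord -mulr_sumr mulrC; apply: ler_wpM2r => //.
  (* telescoping bound 1/(m+1)^2 <= 2/(m+1) - 2/(m+2) *)
  apply: (@le_trans _ _ (2 - 2 / n.+1%:R)); last by rewrite gerBl divr_ge0.
  elim: n => [|n IH]; first by rewrite big_ord0 divr1 subrr.
  rewrite big_ord_recr/=; apply: le_trans (lerD IH (lexx _)) _.
  rewrite -(natr1 n.+1) -(natr1 n); set x : R := n%:R; have x0 : 0 <= x by [].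
  rewrite -subr_ge0.
  have -> : 2 - 2 / (x + 1 + 1) - (2 - 2 / (x + 1) + (x + 1) ^- 2) =
    x / ((x + 1) ^+ 2 * (x + 1 + 1)).
    by field; apply/andP; split; lra.
  by rewrite divr_ge0// mulr_ge0 ?exprn_ge0 ?addr_ge0.
have /(integrable_ae measurableT) : P.-integrable setT (fun w => \sum_(0 <= m <oo) (f m w)%:E)%E.
  apply/integrableP; split => //.
  by under eq_integral do rewrite gee0_abs//.
apply: filterS => w /(_ I) fw.
apply/cvg_series_cvg_0/nnseries_is_cvg => //.
by rewrite -ge0_fin_numE.
Qed.

End ae_convergence.

(** * The integral of the squared process over [0, n h] *)

Section ou_quadratic_variation.
Context {d : measure_display} {Omega : measurableType d} {R : realType}.
Variable P : probability Omega R.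
Variables (W xi : R -> {RV P >-> R}) (theta h : R).
Hypotheses (theta_gt0 : 0 < theta) (h_gt0 : 0 < h).
Hypothesis hxi : ornstein_uhlenbeck P W theta xi.
Local Notation sigma2 := ((2 * theta)^-1).
Local Notation mu := (@lebesgue_measure R).

Definition energy (n : nat) (w : Omega) : R :=
  \int[mu]_(t in `[0, n%:R * h]) (xi t w ^+ 2).

Lemma continuous_sqr_path w : continuous (fun t => xi t w ^+ 2).
Proof.
move=> t; apply: (@continuous_comp _ _ _ (fun t => xi t w) (fun x => x ^+ 2)).
  exact: (ou_continuous hxi).
exact: exprn_continuous.
Qed.

Lemma cvg_energy n w : h / k.+1%:R * \sum_(i < n * k.+1) xi (i%:R * (h / k.+1%:R)) w ^+ 2
  @[k --> \oo] --> energy n w.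
Proof. exact: (@cvg_riemann_sum _ _ _ n (@continuous_sqr_path w) h_gt0). Qed.

(** A pointwise limit of Riemann sums, each a finite combination of random variables. *)
Lemma measurable_energy n : measurable_fun setT (energy n).
Proof.
apply: (measurable_fun_cvg (h := fun k w =>
  h / k.+1%:R * \sum_(i < n * k.+1) xi (i%:R * (h / k.+1%:R)) w ^+ 2)).
  move=> k; apply: measurable_funM => //; apply: measurable_sum => i.
  by apply: measurable_funX; exact: measurable_ou.
by move=> w _; exact: cvg_energy.
Qed.

(* Fatou's lemma along Riemann sums dispenses with the joint measurability of
   (t, w) |-> xi t w that Fubini's theorem would require. *)
Lemma energy_moment2 n :
  (\int[P]_w ((energy n w - n%:R * h * sigma2) ^+ 2)%:E <=
   (n%:R * h * (2 * sigma2 ^+ 2 * (1 + 2 * theta * h) / theta))%:E)%E.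
Proof.
set B := (X in (_ <= X)%E).
pose f k w := ((h / k.+1%:R *
  \sum_(i < n * k.+1) (xi (i%:R * (h / k.+1%:R)) w ^+ 2 - sigma2)) ^+ 2)%:E.
have delta_gt0 k : 0 < h / k.+1%:R by rewrite divr_gt0.
have fE k w : f k w = ((h / k.+1%:R * (\sum_(i < n * k.+1) xi (i%:R * (h / k.+1%:R)) w ^+ 2)
    - n%:R * h * sigma2) ^+ 2)%:E.
  rewrite /f sumrB sumr_const card_ord mulrBr -[_ *+ (n * _)]mulr_natr natrM.
  congr ((_ - _) ^+ 2)%:E.
  by field; rewrite !gt_eqF// addr_gt0.
have mf k : measurable_fun setT (f k).
  apply/measurable_EFinP/measurable_funX/measurable_funM => //; apply: measurable_sum => i.
  by apply: measurable_funB => //; apply: measurable_funX; exact: measurable_ou.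
have f0 k w : (0 <= f k w)%E by rewrite lee_fin sqr_ge0.
have cf w : f k w @[k --> \oo] --> ((energy n w - n%:R * h * sigma2) ^+ 2)%:E.
  under eq_fun do rewrite fE.
  apply: cvg_EFin; first exact: nearW.
  apply: (@cvg_comp _ _ _ _ (fun x : R => x ^+ 2)); last exact: exprn_continuous.
  by apply: cvgB; [exact: cvg_energy|exact: cvg_cst].
under eq_integral do rewrite -(cvg_limn_einf_sup (cf _)).1.
apply: le_trans (fatou P measurableT mf (fun k w _ => f0 k w)) _.
(* The mesh h / (k+1) gives total length n h and is at most h, so the bound no longer depends on
   k. *)
have int_f k : (\int[P]_w f k w <= B)%E.
  apply: le_trans (ou_riemann_moment2 theta_gt0 hxi _ (delta_gt0 k)) _.
  rewrite lee_fin natrM; have -> : n%:R * k.+1%:R * (h / k.+1%:R) = n%:R * h.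
    by field; rewrite gt_eqF// addr_gt0.
  apply: ler_wpM2l; first by rewrite mulr_ge0// ltW.
  apply: ler_wpM2r; first by rewrite invr_ge0 ltW.
  apply: ler_wpM2l; first by rewrite mulr_ge0// sqr_ge0.
  rewrite lerD2l; apply: ler_wpM2l; first by rewrite mulr_ge0// ltW.
  by rewrite ler_pdivrMr//; apply: ler_peMr; [exact: ltW|rewrite ler1n].
(* The lower limit is the limit of infima over tails, each at most the first term of its tail. *)
rewrite limn_einf_lim; apply: lime_le; first exact: is_cvg_einfs.
apply: nearW => k; apply: le_trans (int_f k).
by apply: ereal_inf_lbound; exists k => /=.
Qed.

End ou_quadratic_variation.

(** * Interpolation between consecutive squares *)

Section real_sequences.
Context {R : realType}.

Lemma cvg_sqr0 (u : nat -> R) : u n ^+ 2 @[n --> \oo] --> 0 -> u n @[n --> \oo] --> 0.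
Proof.
move=> u2; have : Num.sqrt (u n ^+ 2) @[n --> \oo] --> Num.sqrt 0.
  by apply: continuous_cvg; [exact: sqrt_continuous|].
rewrite sqrtr0 (_ : (fun n => Num.sqrt (u n ^+ 2)) = (fun n => `|u n|)); last first.
  by apply/funext => n; rewrite sqrtr_sqr.
by move=> /norm_cvg0; apply.
Qed.

Lemma cvg_succ_ratio : (m.+2%:R / m.+1%:R : R) @[m --> \oo] --> (1 : R).
Proof.
have E m : m.+2%:R / m.+1%:R = 1 + m.+1%:R^-1 :> R by rewrite -(natr1 m.+1); field.
rewrite (_ : (fun m => _) = (fun m => 1 + m.+1%:R^-1)); last exact/funext.
have : (1 : R) + m.+1%:R^-1 @[m --> \oo] --> (1 : R) + 0.
  by apply: cvgD; [exact: cvg_cst|exact: cvg_harmonic].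
by rewrite addr0.
Qed.

(** For (r+1)^2 <= n < (r+2)^2, monotonicity places a(n) / n between a((r+1)^2) / (r+2)^2 and
    a((r+2)^2) / (r+1)^2; both tend to L since (r+2) / (r+1) tends to 1. *)
Lemma nondecreasing_cvg_squares (a : nat -> R) (L : R) :
  (forall n, 0 <= a n) -> nondecreasing_seq a ->
  a (m.+1 ^ 2)%N / m.+1%:R ^+ 2 @[m --> \oo] --> L ->
  a n / n%:R @[n --> \oo] --> L.
Proof.
move=> a0 amono bL; set b := fun m => a (m.+1 ^ 2)%N / m.+1%:R ^+ 2.
(* r + 1 is the integer square root of n; the value at n = 0 is arbitrary. *)
have root n : exists r, (0 < n)%N -> (r.+1 ^ 2 <= n < r.+2 ^ 2)%N.
  have [->|n0] := posnP n; first by exists 0%N.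
  have [r rn rmax] := @ex_maxnP (fun r => r.+1 ^ 2 <= n)%N n (ex_intro _ 0%N n0)
    (fun r => leq_trans (ltnW (leq_pmulr r.+1 (ltn0Sn r)))).
  exists r => _; rewrite rn ltnNge; apply/negP => /rmax; rewrite ltnn//.
have {root}[r rP] := choice root.
have r_oo : r n @[n --> \oo] --> \oo.
  apply/cvgnyPge => N; near=> n.
  have /andP[_] : ((r n).+1 ^ 2 <= n < (r n).+2 ^ 2)%N by apply: rP; near: n; exact: nbhs_infty_gt.
  have : (N.+1 ^ 2 <= n)%N by near: n; exact: nbhs_infty_ge.
  by move=> Nn nr; rewrite -ltnS -ltnS -(ltn_exp2r _ _ (isT : 0 < 2)%N) (leq_ltn_trans Nn).
have bL1 : b (r n).+1 * (((r n).+2%:R / (r n).+1%:R) ^+ 2) @[n --> \oo] --> L.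
  rewrite -[X in _ --> X]mulr1 -[X in _ * X](expr1n _ 2).
  apply: (@cvg_comp _ _ _ r (fun m => b m.+1 * ((m.+2%:R / m.+1%:R) ^+ 2)) _ _ _ r_oo).
  apply: cvgM; first by rewrite (cvg_shiftS b).
  apply: (@cvg_comp _ _ _ _ (fun x : R => x ^+ 2)); first exact: cvg_succ_ratio.
  exact: exprn_continuous.
have bL2 : b (r n) * (((r n).+2%:R / (r n).+1%:R) ^- 2) @[n --> \oo] --> L.
  rewrite -[X in _ --> X]mulr1 -[X in _ * X]invr1 -[X in _ * X^-1](expr1n _ 2).
  apply: (@cvg_comp _ _ _ r (fun m => b m * ((m.+2%:R / m.+1%:R) ^- 2)) _ _ _ r_oo).
  apply: cvgM => //; apply: cvgV; first by rewrite expr1n oner_neq0.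
  apply: (@cvg_comp _ _ _ _ (fun x : R => x ^+ 2)); first exact: cvg_succ_ratio.
  exact: exprn_continuous.
apply: squeeze_cvgr bL2 bL1.
near=> n; have n0 : (0 < n)%N by near: n; exact: nbhs_infty_gt.
have /andP[rn nr] := rP n n0.
have nR0 : 0 < n%:R :> R by rewrite ltr0n.
apply/andP; split.
- have -> : b (r n) * ((r n).+2%:R / (r n).+1%:R) ^- 2 = a ((r n).+1 ^ 2)%N / (r n).+2%:R ^+ 2.
    by rewrite /b; field; rewrite !gt_eqF// ?addr_gt0// addrC.
  apply: ler_pM => //; first exact: amono.
  by rewrite lef_pV2 ?posrE ?exprn_gt0// -natrX ler_nat ltnW.
- have -> : b (r n).+1 * ((r n).+2%:R / (r n).+1%:R) ^+ 2 = a ((r n).+2 ^ 2)%N / (r n).+1%:R ^+ 2.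
    by rewrite /b; field; rewrite !gt_eqF// ?addr_gt0// addrC.
  apply: ler_pM => //.
  - exact/amono/ltnW.
  - by rewrite lef_pV2 ?posrE ?exprn_gt0// -natrX ler_nat.
Unshelve. all: by end_near.
Qed.

End real_sequences.

(** * The operator norm *)

Section operator_bound.
Context {R : realType}.

(** For z < 0, e^x >= 1 + x at z and at - z gives 1 - e^z <= - z <= e^(-z) - 1. *)
Lemma dist1_expR_le (z : R) : `|1 - expR z| <= expR `|z| - 1.
Proof.
have [z0|z0] := leP 0 z.
  by rewrite distrC !ger0_norm// subr_ge0 -expR0 ler_expR.
rewrite (ltr0_norm z0) ger0_norm; last by rewrite subr_ge0 -expR0 ler_expR ltW.
by have := expR_ge1Dx z; have := expR_ge1Dx (- z); lra.
Qed.

(** Factor out e^(- a t), which is at most 1. The sign of [b] is left free because the estimator can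
    be negative. *)
Lemma dist_expR_le (h a b t : R) : 0 <= a -> 0 <= t <= h ->
  `|expR (- a * t) - expR (- b * t)| <= expR (`|a - b| * h) - 1.
Proof.
move=> a0 /andP[t0 th].
have -> : expR (- a * t) - expR (- b * t) = expR (- a * t) * (1 - expR ((a - b) * t)).
  by rewrite mulrBr mulr1 -expRD; congr (_ - expR _); ring.
rewrite normrM (ger0_norm (expR_ge0 _)).
apply: (@le_trans _ _ (1 * (expR `|(a - b) * t| - 1))).
  by rewrite ler_pM ?expR_ge0 ?dist1_expR_le// expR_le1 mulNr oppr_le0 mulr_ge0.
rewrite mul1r lerD2r ler_expR normrM (ger0_norm t0).
by rewrite ler_wpM2l.
Qed.

Lemma lambda_delta_setT (h : R) : 0 < h -> lambda_delta h setT = (h + 1)%:E.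
Proof.
move=> h0; rewrite /lambda_delta /mrestr setTI /= measure_addE /=.
rewrite lebesgue_measure_itv/= lte_fin h0 oppr0 adde0 diracE mem_set ?EFinD//.
by rewrite /= in_itv/= lexx ltW.
Qed.

Lemma le_norm_L2_fun_atom (h : R) (x : H h) : 0 < h -> `|L2_fun x h| <= `|x|.
Proof.
move=> h0; rewrite H_normE// -sqrtr_sqr ler_wsqrtr// lerDr.
by apply: Rintegral_ge0 => t _; exact: sqr_ge0.
Qed.

(** A uniform bound controls the L^2 norm up to the square root of the total mass h + 1. *)
Lemma H_norm_le (h K : R) (y : H h) (g : measurableTypeR R -> R) : 0 < h -> 0 <= K ->
  measurable_fun setT g -> (forall t, `|g t| <= K) ->
  {ae lambda_delta h, forall t, L2_fun y t = g t} ->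
  `|y| <= Num.sqrt (h + 1) * K.
Proof.
move=> h0 K0 mg gK yg.
have yN : (`|y|%:E = 'N[lambda_delta h]_2[EFin \o g])%E.
  rewrite -(ae_Lnorm2 (measurable_L2_fun y) mg); last by apply: filterS yg => t ->.
  exact: (finite_norm_fine (L2_rep y)).
have N2 : ((`|y| ^+ 2)%:E <= ((h + 1) * K ^+ 2)%:E)%E.
  have -> : ((`|y| ^+ 2)%:E = \int[lambda_delta h]_t (`|g t| `^ 2)%:E)%E.
    by rewrite -powR_mulrn// -poweR_EFin yN poweR_Lnorm.
  apply: (@le_trans _ _ (\int[lambda_delta h]_t (cst (K ^+ 2)%:E t))%E).
    apply: ge0_le_integral => //.
    - apply/measurable_EFinP.
      apply: (@measurableT_comp _ _ _ _ _ _ (fun z : R => z `^ 2) _ (fun t => `|g t|)) => //.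
      exact: measurableT_comp.
    - move=> t _; rewrite powR_mulrn// lee_fin.
      by rewrite lerXn2r ?nnegrE.
  by rewrite integral_cst// -[X in (_ * X)%E]/(lambda_delta h setT)
    lambda_delta_setT// -EFinM mulrC.
rewrite -(ger0_norm (normr_ge0 y)) -sqrtr_sqr -(ger0_norm K0) -(sqrtr_sqr K).
by rewrite -sqrtrM; [rewrite ler_wsqrtr|rewrite addr_ge0// ltW].
Qed.

Lemma measurable_rho_fun (h u c : R) :
  measurable_fun [set: measurableTypeR R] (rho_fun h u c).
Proof.
apply: measurable_funM; first exact: measurable_indic.
apply: measurable_funM => //.
by apply: measurableT_comp => //; exact: measurable_funM.
Qed.

(** The difference is x(h) times a difference of exponentials that is uniformly small on [0, h], and
    |x(h)| is at most the norm of x thanks to the atom at h. *)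
Lemma rho_dist_le (h a b : R) (x : H h) : 0 < h -> 0 <= a ->
  `|rho h a x - rho h b x| <= Num.sqrt (h + 1) * (expR (`|a - b| * h) - 1) * `|x|.
Proof.
move=> h0 a0; set c := L2_fun x h.
have eps0 : 0 <= expR (`|a - b| * h) - 1.
  by rewrite subr_ge0 -expR0 ler_expR mulr_ge0// ltW.
rewrite -mulrA.
apply: (@le_trans _ _ (Num.sqrt (h + 1) * ((expR (`|a - b| * h) - 1) * `|c|))); last first.
  by rewrite !ler_wpM2l ?sqrtr_ge0// le_norm_L2_fun_atom.
apply: (@H_norm_le h _ _ (fun t => rho_fun h a c t - rho_fun h b c t)) => //.
- by rewrite mulr_ge0.
- by apply: measurable_funB; exact: measurable_rho_fun.
- move=> t; rewrite /rho_fun -mulrBr -mulrBl !normrM mulrA; apply: ler_wpM2r => //.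
  rewrite indicE; case: (boolP (t \in _)) => [|_]; last by rewrite normr0 mul0r.
  by rewrite inE/= in_itv/= => th; rewrite normr1 mul1r dist_expR_le.
- apply: filterS3 (filterI (L2_addE (rho h a x) (L2_opp (rho h b x))) (L2_oppE (rho h b x)))
    (L2_classE (Lfun_Sub (lee1n 2) (rho_fun_Lfun h a c)))
    (L2_classE (Lfun_Sub (lee1n 2) (rho_fun_Lfun h b c))) => t.
  by move=> [-> ->] -> ->.
Qed.

Lemma opnorm_rho_le (h a b : R) : 0 < h -> 0 <= a ->
  (opnorm (rho h a \- rho h b)%R <= (Num.sqrt (h + 1) * (expR (`|a - b| * h) - 1))%:E)%E.
Proof.
move=> h0 a0; apply: ge_ereal_sup => _ [x /= x1 <-]; rewrite lee_fin.
apply: le_trans (rho_dist_le _ _ h0 a0) _.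
rewrite ler_piMr// mulr_ge0 ?sqrtr_ge0// subr_ge0 -expR0 ler_expR mulr_ge0//.
exact: ltW.
Qed.

(** The zero vector lies in the unit ball, so the supremum is over a nonempty set of nonnegative
    numbers. *)
Lemma opnorm_ge0 (V W : normedModType R) (f : V -> W) : (0 <= opnorm f)%E.
Proof.
apply: (@le_trans _ _ `|f 0|%:E); first by rewrite lee_fin.
by apply: ereal_sup_ubound; exists 0 => //=; rewrite normr0.
Qed.

Lemma cvg_opnorm_rho (h a : R) (b : nat -> R) : 0 < h -> 0 <= a ->
  b n @[n --> \oo] --> a ->
  opnorm (rho h a \- rho h (b n)) @[n --> \oo] --> 0%E.
Proof.
move=> h0 a0 ba.
apply: (@squeeze_cvge _ _ _ _ (cst 0%E) _
  (fun n => (Num.sqrt (h + 1) * (expR (`|a - b n| * h) - 1))%:E)).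
- by apply: nearW => n; rewrite opnorm_ge0 opnorm_rho_le.
- exact: cvg_cst.
- apply: cvg_EFin; first exact: nearW.
  have : Num.sqrt (h + 1) * (expR (`|a - b n| * h) - 1) @[n --> \oo] -->
      Num.sqrt (h + 1) * (expR (`|a - a| * h) - 1).
    apply: cvgM; first exact: cvg_cst.
    apply: cvgB; last exact: cvg_cst.
    apply: (@cvg_comp _ _ _ _ expR); last exact: continuous_expR.
    apply: cvgM; last exact: cvg_cst.
    by apply: cvg_norm; apply: cvgB => //; exact: cvg_cst.
  by rewrite subrr normr0 mul0r expR0 subrr mulr0.
Qed.

End operator_bound.

(** * Strong consistency of the estimator *)

Section mle_consistency.
Context {d : measure_display} {Omega : measurableType d} {R : realType}.
Variable P : probability Omega R.
Variables (W xi : R -> {RV P >-> R}) (theta h : R).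
Hypotheses (theta_gt0 : 0 < theta) (h_gt0 : 0 < h).
Hypothesis hxi : ornstein_uhlenbeck P W theta xi.
Local Notation sigma2 := ((2 * theta)^-1).
Local Notation mu := (@lebesgue_measure R).
Local Notation A := (energy xi h).

Lemma energy_ge0 n w : 0 <= A n w.
Proof. by apply: Rintegral_ge0 => t _; exact: sqr_ge0. Qed.

Lemma nondecreasing_energy w : nondecreasing_seq (A ^~ w).
Proof.
move=> n m nm; rewrite -subr_ge0.
have nmh : n%:R * h <= m%:R * h by rewrite ler_wpM2r ?ler_nat// ltW.
have n0 : 0 <= n%:R * h by rewrite mulr_ge0// ltW.
have := @Rintegral_itvB _ _ (BLeft 0) (BRight (m%:R * h)) (n%:R * h)
  (continuous_integrable_itv 0 (m%:R * h) (@continuous_sqr_path _ _ _ _ _ _ _ hxi w)).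
rewrite !bnd_simp => /(_ n0 nmh) ->.
by apply: Rintegral_ge0 => t _; exact: sqr_ge0.
Qed.

(** At n = (m+1)^2 the mean square of the normalized deviation is O(1 / (m+1)^2), hence summable;
    the convergence along squares extends to all n by monotonicity. *)
Lemma ae_energy_cvg : {ae P, forall w, A n w / n%:R @[n --> \oo] --> h * sigma2}.
Proof.
pose B := 2 * sigma2 ^+ 2 * (1 + 2 * theta * h) / theta.
pose f (m : nat) w := ((A (m.+1 ^ 2)%N w - (m.+1 ^ 2)%N%:R * h * sigma2) / m.+1%:R ^+ 2) ^+ 2.
have mA m : measurable_fun setT (fun w => (A (m.+1 ^ 2)%N w - (m.+1 ^ 2)%N%:R * h * sigma2) ^+ 2).
  by apply: measurable_funX; apply: measurable_funB => //; exact: measurable_energy hxi _.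
have fE m w : f m w = (m.+1%:R ^+ 4)^-1 *
    (A (m.+1 ^ 2)%N w - (m.+1 ^ 2)%N%:R * h * sigma2) ^+ 2.
  by rewrite /f expr_div_n -exprM mulrC.
have : {ae P, forall w, f m w @[m --> \oo] --> 0}.
  (* The second moment is at most (m+1)^2 h B, and the squared normalization divides it by
     (m+1)^4. *)
  apply: (@ae_cvg0_summable _ _ _ P f (h * B)) => [m|m w|m].
  - by rewrite (funext (fE m)); exact: measurable_funM.
  - exact: sqr_ge0.
  - under eq_integral do rewrite fE EFinM.
    rewrite ge0_integralZl//; last 2 first.
    + exact/measurable_EFinP.
    + by move=> w _; rewrite lee_fin sqr_ge0.
    apply: le_trans (lee_wpmul2l _ (energy_moment2 theta_gt0 h_gt0 hxi _)) _.
      by rewrite lee_fin invr_ge0 exprn_ge0.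
    rewrite -EFinM lee_fin natrX -/B le_eqVlt; apply/orP; left; apply/eqP.
    by field; rewrite gt_eqF// addrC natr1.
apply: filterS => w /cvg_sqr0 fw.
apply: nondecreasing_cvg_squares.
- by move=> n; exact: energy_ge0.
- exact: nondecreasing_energy.
- have E m : A (m.+1 ^ 2)%N w / m.+1%:R ^+ 2 =
      (A (m.+1 ^ 2)%N w - (m.+1 ^ 2)%N%:R * h * sigma2) / m.+1%:R ^+ 2 + h * sigma2.
    by rewrite natrX; field; rewrite !gt_eqF// addrC natr1.
  under eq_fun do rewrite E.
  have H : (A (m.+1 ^ 2)%N w - (m.+1 ^ 2)%N%:R * h * sigma2) / m.+1%:R ^+ 2 + h * sigma2
      @[m --> \oo] --> 0 + h * sigma2 by apply: cvgD => //; exact: cvg_cst.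
  by rewrite add0r in H.
Qed.

(** The fourth moment does not depend on time, so the squares of these ratios have means
    proportional to 1 / n^2. *)
Lemma ae_sqr_ou_cvg0 : {ae P, forall w, xi (n%:R * h) w ^+ 2 / (n%:R * h) @[n --> \oo] --> 0}.
Proof.
pose f (m : nat) w := (xi (m.+1%:R * h) w ^+ 2 / (m.+1%:R * h)) ^+ 2.
have fE m w : f m w = ((m.+1%:R * h) ^+ 2)^-1 * xi (m.+1%:R * h) w ^+ 4.
  by rewrite /f expr_div_n -exprM mulrC.
have mxi m : measurable_fun setT (fun w => xi (m.+1%:R * h) w ^+ 4).
  by apply: measurable_funX; exact: measurable_ou.
have : {ae P, forall w, f m w @[m --> \oo] --> 0}.
  apply: (@ae_cvg0_summable _ _ _ P f (3 * sigma2 ^+ 2 / h ^+ 2)) => [m|m w|m].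
  - by rewrite (funext (fE m)); exact: measurable_funM.
  - exact: sqr_ge0.
  - under eq_integral do rewrite fE EFinM.
    rewrite ge0_integralZl//; last 3 first.
    + exact/measurable_EFinP.
    + by move=> w _; rewrite lee_fin exprn_even_ge0.
    + by rewrite lee_fin invr_ge0 sqr_ge0.
    rewrite (ou_moment4 hxi _).2 -EFinM lee_fin le_eqVlt; apply/orP; left; apply/eqP.
    by field; rewrite !gt_eqF// addrC natr1.
apply: filterS => w /cvg_sqr0 fw.
by rewrite -(cvg_shiftS (fun n => xi (n%:R * h) w ^+ 2 / (n%:R * h))).
Qed.

(** The numerator tends to 1 and the denominator to (2 / h) (h / (2 theta)) = 1 / theta. *)
Lemma ae_mle_cvg : {ae P, forall w, mle xi (n%:R * h) w @[n --> \oo] --> theta}.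
Proof.
apply: filterS2 ae_energy_cvg ae_sqr_ou_cvg0 => w Aw xiw.
have x0 : xi 0 w ^+ 2 / (n%:R * h) @[n --> \oo] --> 0.
  rewrite -(cvg_shiftS (fun n => xi 0 w ^+ 2 / (n%:R * h))).
  rewrite (_ : (fun n => _) = (fun n => xi 0 w ^+ 2 / h * n.+1%:R^-1)); last first.
    by apply/funext => n; field; rewrite !gt_eqF// addrC natr1.
  have H : xi 0 w ^+ 2 / h * n.+1%:R^-1 @[n --> \oo] --> xi 0 w ^+ 2 / h * 0.
    by apply: cvgM; [exact: cvg_cst|exact: cvg_harmonic].
  by rewrite mulr0 in H.
have den : 2 / h * (A n w / n%:R) @[n --> \oo] --> 2 / h * (h * sigma2).
  by apply: cvgM => //; exact: cvg_cst.
have denE : 2 / h * (h * sigma2) = theta^-1 by field; rewrite !gt_eqF.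
rewrite denE in den.
have E n : mle xi (n%:R * h) w =
    (1 + xi 0 w ^+ 2 / (n%:R * h) - xi (n%:R * h) w ^+ 2 / (n%:R * h)) /
    (2 / h * (A n w / n%:R)).
  rewrite /mle -/(A n w); congr (_ / _).
  (* At n = 0 both sides vanish, by the convention that the inverse of 0 is 0. *)
  have [->|n0] := posnP n; first by rewrite !mul0r !invr0 !mulr0 mul0r.
  by field; rewrite !gt_eqF// ltr0n.
under eq_fun do rewrite E.
rewrite (_ : theta = (1 + 0 - 0) / theta^-1); last by rewrite addr0 subr0 invrK mul1r.
apply: cvgM; first by apply: cvgB => //; apply: cvgD => //; exact: cvg_cst.
by apply: cvgV => //; rewrite invr_eq0 gt_eqF.
Qed.

End mle_consistency.

Theorem proposition1 (R : realType) (d : measure_display)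
  (Omega : measurableType d) (P : probability Omega R)
  (W xi : R -> {RV P >-> R}) (theta h : R)
  (theta_gt0 : 0 < theta) (h_gt0 : 0 < h)
  (hW : two_sided_wiener P W) (hxi : ornstein_uhlenbeck P W theta xi) :
  {ae P, forall w,
    opnorm (rho h theta \- rho h (mle xi (n%:R * h) w))
      @[n --> \oo] --> 0%E}.
Proof.
(* The remaining argument is deterministic, path by path: the operator norm depends on the path only
   through the value of the estimator. *)
apply: filterS (ae_mle_cvg theta_gt0 h_gt0 hxi) => w mle_cvg.
exact: (cvg_opnorm_rho h_gt0 (ltW theta_gt0) mle_cvg).
Qed.
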